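(* Let $n\ge 1$, $T>0$, and for $j=1,\dots,n$ let $\theta_j=\gamma_j/q_j$ with co-prime integers $\gamma_j\ge 1$, $q_j\ge 2$. Let $q$ be the least common multiple of $q_1,\dots,q_n$. For $j=1,\dots,n$ and $r=1,\dots,n+1$ let $p_{j,r}:\mathbb{R}\to\mathbb{C}$ be periodic, highly oscillatory continuous functions of the form $$p_{j,r}(t)=f_{j,r}(t)\,e^{i\omega t},\qquad \omega\gg 1,$$ which can be written as $p_{j,r}(t)=\bar p_{j,r}(t^{1/q})$ (for $t\ge 0$), where the functions $\bar p_{j,r}$ are analytic in a neighborhood of the origin. Let $(v_1,\dots,v_n)$ be the solution on $\Lambda=[0,T]$ of $$D_C^{\theta_j}v_j(t)=\sum_{r=1}^{n}p_{j,r}(t)\,v_r(t)+p_{j,n+1}(t),\qquad v_j^{(k)}(0)=v_{j,0}^{(k)},\quad k=0,1,\dots,\lceil\theta_j\rceil-1,\quad j=1,\dots,n.$$ Then, in a neighborhood of the origin, $v_j$ has the (convergent) series representation $$v_j(t)=\psi_j(t)+\sum_{\mu=\theta_j q}^{\infty}\bar v_{j,\mu}\,t^{\mu/q},\qquad j=1,2,\dots,n,$$ where $\psi_j(t)=\sum_{k=0}^{\lceil\theta_j\rceil-1}\frac{v_{j,0}^{(k)}}{k!}t^k$ and the $\bar v_{j,\mu}$ are coefficients determined by the data of the problem.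
   Context: $\lceil\cdot\rceil$ is the ceiling function. For $\alpha>0$ the Riemann-Liouville fractional integral is $I^{\alpha}g(t)=\frac{1}{\Gamma(\alpha)}\int_0^t (t-s)^{\alpha-1}g(s)\,ds$. The Caputo derivative of order $\theta_j$ is $D_C^{\theta_j}g=I^{\lceil\theta_j\rceil-\theta_j}\,\partial_t^{\lceil\theta_j\rceil}g$. The initial values $v_{j,0}^{(k)}$ are given numbers. For continuous $p_{j,r}$ the initial value problem has a unique continuous solution $(v_1,\dots,v_n)$ on $\Lambda$; equivalently, it is the continuous solution of $v_j=\psi_j+\sum_{r=1}^n I^{\theta_j}(p_{j,r}v_r)+I^{\theta_j}(p_{j,n+1})$, $j=1,\dots,n$. The notation $\omega\gg1$ means that $\omega$ is a large real parameter. *)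

(* Defs.v *)
From HB Require Import structures.
From mathcomp Require Import all_boot all_order all_algebra.
From mathcomp Require Import complex.
From mathcomp Require Import all_classical all_reals all_analysis.
Set Implicit Arguments.
Unset Strict Implicit.
Unset Printing Implicit Defensive.
Import Order.TTheory GRing.Theory Num.Theory.
Import numFieldNormedType.Exports.
Local Open Scope classical_set_scope.
Local Open Scope complex_scope.
Local Open Scope ring_scope.

Section Defs.
Context {R : realType}.
Local Notation mu := (@lebesgue_measure R).

(* R[i] carries no topology of its own; the regular algebra R[i]^o carries the
   one given by the complex modulus, hence the casts to R[i]^o below. *)

Definition cexpi (x : R) : R[i] := cos x +i* sin x.

Definition gamma_fun (a : R) : R :=
  \int[mu]_(x in `]0, +oo[) (x `^ (a - 1) * expR (- x)).

Definition cintegrable (D : set R) (g : R -> R[i]) : Prop :=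
  mu.-integrable D (EFin \o (fun s => complex.Re (g s))) /\
  mu.-integrable D (EFin \o (fun s => complex.Im (g s))).

Definition cintegral (D : set R) (g : R -> R[i]) : R[i] :=
  (\int[mu]_(s in D) complex.Re (g s)) +i* (\int[mu]_(s in D) complex.Im (g s)).

(* I^a g *)
Definition frac_int (a : R) (g : R -> R[i]) (t : R) : R[i] :=
  (gamma_fun a)^-1%:C *
  cintegral `[0, t] (fun s => ((t - s) `^ (a - 1))%:C * g s).

Definition nceil (theta : R) : nat := `|Num.ceil theta|%N.

(* Derivative relative to [0, T], hence one-sided at the end points. *)
Definition has_derivative_on (T : R) (g dg : R -> R[i]) : Prop :=
  forall t : R, t \in `[0, T] ->
    (fun s : R => (g s - g t) / (s - t)%:C : R[i]^o)
      @ within `[0, T] t^' --> (dg t : R[i]^o).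

(* g is absolutely continuous on [0, T], with almost everywhere derivative w. *)
Definition is_primitive_on (T : R) (w g : R -> R[i]) : Prop :=
  cintegrable `[0, T] w /\
  forall t : R, t \in `[0, T] -> g t = g 0 + cintegral `[0, t] w.

(* D k is the k-th derivative of g on [0, T] for k <= m (m >= 1), where g is in
   AC^m: the derivatives of order < m are classical, and the one of order m is
   the summable almost everywhere derivative of the absolutely continuous
   D m.-1 (for a Caputo derivative it is typically singular at the origin). *)
Definition derivatives_on (T : R) (m : nat) (g : R -> R[i])
    (D : nat -> R -> R[i]) : Prop :=
  [/\ forall t : R, t \in `[0, T] -> D 0%N t = g t,
      forall k : nat, (k.+1 < m)%N -> has_derivative_on T (D k) (D k.+1) &
      is_primitive_on T (D m) (D m.-1)].

(* Caputo derivative of order theta of a function with derivatives D k. *)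
Definition caputo (theta : R) (D : nat -> R -> R[i]) : R -> R[i] :=
  frac_int ((nceil theta)%:R - theta) (D (nceil theta)).

Definition psi (theta : R) (v0 : nat -> R[i]) (t : R) : R[i] :=
  \sum_(k < nceil theta) v0 k / (k`!)%:R * (t ^+ k)%:C.

(* The coefficients p j r have r < n.+1; the last one is the source term. *)
Definition rhs_coef (n : nat) (p : 'I_n -> 'I_n.+1 -> R -> R[i])
    (j r : 'I_n) : R -> R[i] := p j (widen_ord (leqnSn n) r).

Definition rhs_source (n : nat) (p : 'I_n -> 'I_n.+1 -> R -> R[i])
    (j : 'I_n) : R -> R[i] := p j ord_max.

(* The equation is required on ]0, T] only: an integral over [0, t] vanishes at
   t = 0, whereas the right-hand side need not. *)
Definition caputo_solution (n : nat) (T : R) (theta : 'I_n -> R)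
    (p : 'I_n -> 'I_n.+1 -> R -> R[i]) (v0 : 'I_n -> nat -> R[i])
    (v : 'I_n -> R -> R[i]) : Prop :=
  exists D : 'I_n -> nat -> R -> R[i], forall j : 'I_n,
    [/\ derivatives_on T (nceil (theta j)) (v j) (D j),
        forall t : R, t \in `]0, T] ->
          caputo (theta j) (D j) t
          = \sum_(r < n) rhs_coef p j r t * v r t + rhs_source p j t &
        forall k : nat, (k < nceil (theta j))%N -> D j k 0 = v0 j k].

Definition volterra_solution (n : nat) (T : R) (theta : 'I_n -> R)
    (p : 'I_n -> 'I_n.+1 -> R -> R[i]) (v0 : 'I_n -> nat -> R[i])
    (v : 'I_n -> R -> R[i]) : Prop :=
  forall (j : 'I_n) (t : R), t \in `[0, T] ->
    v j t = psi (theta j) (v0 j) t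
      + \sum_(r < n) frac_int (theta j) (fun s => rhs_coef p j r s * v r s) t
      + frac_int (theta j) (rhs_source p j) t.

(* For coefficients that are merely continuous, the continuous solution of the
   integral equations need not have the derivatives that the pointwise Caputo
   problem asks for, so a solution is one in either sense. *)
Definition ivp_solution (n : nat) (T : R) (theta : 'I_n -> R)
    (p : 'I_n -> 'I_n.+1 -> R -> R[i]) (v0 : 'I_n -> nat -> R[i])
    (v : 'I_n -> R -> R[i]) : Prop :=
  (forall j : 'I_n, {within `[0, T], continuous (v j : R -> R[i]^o)}) /\
  (caputo_solution T theta p v0 v \/ volterra_solution T theta p v0 v).

(* Some power series centred at c converges to g in a neighbourhood of c. *)
Definition analytic_at (g : R[i] -> R[i]) (c : R[i]) : Prop :=
  exists (a : nat -> R[i]) (rho : R), 0 < rho /\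
    forall z : R[i], `|z - c| < rho%:C ->
      (fun N : nat => \sum_(k < N) a k * (z - c) ^+ k : R[i]^o) @ \oo
        --> (g z : R[i]^o).

End Defs.

(* Main.v *)
Require Import Defs.
From HB Require Import structures.
From mathcomp Require Import all_boot all_order all_algebra.
From mathcomp Require Import complex.
From mathcomp Require Import all_classical all_reals all_analysis.
From mathcomp Require Import measurable_realfun.
From mathcomp Require Import ring lra.
Set Implicit Arguments.
Unset Strict Implicit.
Unset Printing Implicit Defensive.
Import Order.TTheory GRing.Theory Num.Theory.
Import numFieldNormedType.Exports.
Local Open Scope classical_set_scope.
Local Open Scope complex_scope.
Local Open Scope ring_scope.

(** Why the theorem is true.  Put G_j = sum_r p_(j,r) v_r + p_(j,n+1).

    Both notions of solution lead to the Volterra system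
    v_j = psi_j + I^(theta_j) G_j.  For a Caputo solution, apply I^theta to
    I^(m - theta) D_m = G, where m = ceil theta: the semigroup law
    I^theta I^(m - theta) = I^m ([real_frac_int_semigroup]) leaves I^m D_m,
    which is v minus its Taylor polynomial at 0 ([taylor_frac_int]); this is
    [caputo_volterra].  The semigroup law is the associativity of convolution
    for the kernels x_+^(a-1) / Gamma(a), and it needs Euler's formula
    Gamma(a) Gamma(b) = B(a,b) Gamma(a+b), proved with Tonelli's theorem
    ([gamma_erealM]).

    In the variable z = t^(1/q) the p_(j,r) are power series, and I^theta_j
    sends z^i to a multiple of z^(i + m_j), where m_j = theta_j q is a positive
    integer ([frac_int_powR]).  Comparing coefficients gives a recursion in
    which every coefficient depends on those of lower index only, so a formal
    solution W exists ([recursion_exists]).  The multipliers of z^i are bounded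
    uniformly in i ([frac_int_coef_le]), hence W grows at most geometrically
    ([recursion_bound]).

    The series is neither summed nor integrated term by term.  Instead any
    solution v is compared with the partial sums S_N of the formal one: S_N
    satisfies the Volterra system up to a residual of size 2^-N, uniformly on
    an interval [0, delta[ ([rhs_residual_bound]), and there the Volterra
    operator contracts differences by a factor 1/2, so that |v - S_N| is at
    most twice the residual ([halving_iteration], [fractional_series]).
    Convergence of the series and its equality with v come out together, and
    delta depends on the p_(j,r), on theta and on T only. *)

(** * Affine substitution in Lebesgue integrals *)

Section AffineSubstitution.
Context {R : realType}.
Local Notation mu := (@lebesgue_measure R).

(** The measure that is c times the image of Lebesgue measure under
    x |-> c x + d gives every interval its length, so it is Lebesgue measure.
    The kernels to which this applies are neither bounded nor continuous, so
    f is only assumed to be measurable. *)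
Lemma ge0_integral_affine (c d : R) (f : R -> \bar R) : 0 < c ->
  measurable_fun [set: R] f -> (forall x, 0 <= f x)%E ->
  (\int[mu]_x f x = c%:E * \int[mu]_x f (c * x + d)%R)%E.
Proof.
move=> c0 mf f0.
pose phi : measurableTypeR R -> measurableTypeR R := fun x : R => c * x + d.
have mphi : measurable_fun setT phi.
  have : measurable_fun [set: R] (fun x : R => c * x + d).
    by apply: measurable_funD => //; exact: measurable_funM.
  by [].
pose nu0 : {measure set (measurableTypeR R) -> \bar R} :=
  measure_function_pushforward__canonical__measure_function_Measure mu mphi.
pose nu : {measure set (measurableTypeR R) -> \bar R} := mscale (NngNum (ltW c0)) nu0.
have nuE A : measurable A -> mu A = nu A.
  apply: lebesgue_measure_unique => _ [[a b] _ <-] /=.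
  rewrite /nu/nu0/= /mscale/= /pushforward.
  rewrite (_ : _ @^-1` _ = `](a - d) / c, (b - d) / c]%classic); last first.
    by apply/seteqP; split=> x /=; rewrite !in_itv/=;
      rewrite ltr_pdivrMr// ler_pdivlMr// ltrBlDr lerBrDr (mulrC x).
  rewrite !lebesgue_measure_itv/= !lte_fin ltr_pM2r ?invr_gt0// ltrD2r.
  case: ifP => _; last by rewrite mule0.
  rewrite -!EFinB -EFinM; congr EFin; field.
  by rewrite gt_eqF.
transitivity (\int[nu]_x f x)%E.
  by apply: eq_measure_integral => A mA _; exact: nuE.
rewrite ge0_integral_mscale//; congr (_ * _)%E.
by rewrite ge0_integral_pushforward.
Qed.
End AffineSubstitution.

(** * Truncated powers and the Euler integrals *)

Section Kernel.
Context {R : realType}.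
Local Notation mu := (@lebesgue_measure R).
Implicit Types (a b c d t u x : R).

(** The truncated power x_+^(a-1).  Extending the kernel of I^a by 0 to the
    whole line turns fractional integrals into convolutions on R. *)
Definition tpow a x : R := if 0 < x then x `^ (a - 1) else 0.

Lemma tpow_ge0 a x : 0 <= tpow a x.
Proof. by rewrite /tpow; case: ifP => // _; exact: powR_ge0. Qed.

Lemma tpow_gt0 a x : 0 < x -> 0 < tpow a x.
Proof. by move=> x0; rewrite /tpow x0 powR_gt0. Qed.

Lemma tpow_le0 a x : x <= 0 -> tpow a x = 0.
Proof. by rewrite /tpow ltNge => ->. Qed.

Lemma tpowE a x : 0 < x -> tpow a x = x `^ (a - 1).
Proof. by rewrite /tpow => ->. Qed.

Lemma measurable_tpow a : measurable_fun [set: R] (tpow a).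
Proof.
apply: measurable_fun_ifT; [exact: measurable_fun_ltr|exact: measurable_powR|].
exact: measurable_cst.
Qed.

Lemma measurable_tpow_comp {disp : measure_display} (T : measurableType disp) a (f : T -> R) :
  measurable_fun [set: T] f -> measurable_fun [set: T] (fun y : T => tpow a (f y)).
Proof. by move=> mf; apply: (measurableT_comp (measurable_tpow a)). Qed.

(** The Euler integrals live first in the extended reals, where Tonelli's
    theorem applies before their finiteness is known. *)
Definition gamma_ereal a : \bar R := (\int[mu]_x (tpow a x * expR (- x))%:E)%E.
Definition beta_ereal a b : \bar R := (\int[mu]_x (tpow a (1 - x) * tpow b x)%:E)%E.

Lemma gamma_ereal_ge0 a : (0 <= gamma_ereal a)%E.
Proof.
by apply: integral_ge0 => x _; rewrite lee_fin mulr_ge0 ?tpow_ge0 ?expR_ge0.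
Qed.

Lemma beta_ereal_ge0 a b : (0 <= beta_ereal a b)%E.
Proof. by apply: integral_ge0 => x _; rewrite lee_fin mulr_ge0 ?tpow_ge0. Qed.

Lemma measurable_tpowM a b t u :
  measurable_fun [set: R] (fun s : R => tpow a (t - s) * tpow b (s - u)).
Proof.
apply: measurable_funM; apply: measurable_tpow_comp; first exact: measurable_funB.
by apply: measurable_funB => //; exact: measurable_cst.
Qed.

(** For u < t the substitution s = u + (t - u) x moves the support of the
    integrand to ]0, 1[ and pulls out the powers of t - u; for t <= u the
    supports of the two factors are disjoint. *)
Lemma tpow_convolution a b t u :
  (\int[mu]_s (tpow a (t - s) * tpow b (s - u))%:E =
   beta_ereal a b * (tpow (a + b) (t - u))%:E)%E.
Proof.
have [tu|ut] := leP t u.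
  rewrite (tpow_le0 _ (_ : t - u <= 0)) ?subr_le0// mule0.
  rewrite integral0_eq// => s _.
  have [su|us] := leP s u.
    by rewrite (tpow_le0 b) ?subr_le0// mulr0.
  by rewrite (tpow_le0 a) ?subr_le0 ?mul0r// (le_trans tu)// ltW.
have tu0 : 0 < t - u by rewrite subr_gt0.
rewrite (@ge0_integral_affine _ (t - u) u)//; last 2 first.
  by apply/measurable_EFinP; exact: measurable_tpowM.
  by move=> x; rewrite lee_fin mulr_ge0 ?tpow_ge0.
rewrite (tpowE _ tu0).
have E x : tpow a (t - ((t - u) * x + u)) * tpow b ((t - u) * x + u - u) =
    (t - u) `^ (a - 1) * (t - u) `^ (b - 1) * (tpow a (1 - x) * tpow b x).
  rewrite addrK (_ : t - _ = (t - u) * (1 - x)); last by ring.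
  have kM c y : tpow c ((t - u) * y) = (t - u) `^ (c - 1) * tpow c y.
    rewrite /tpow pmulr_rgt0//; case: ifP => y0; last by rewrite mulr0.
    by rewrite powRM// ltW.
  by rewrite !kM mulrACA.
under eq_integral do rewrite E EFinM.
rewrite ge0_integralZl//; last 3 first.
  apply/measurable_EFinP; have := measurable_tpowM a b 1 0.
  by under eq_fun do rewrite subr0.
  by move=> x _; rewrite lee_fin mulr_ge0 ?tpow_ge0.
  by rewrite lee_fin mulr_ge0 ?powR_ge0.
rewrite muleA -EFinM muleC; congr (_ * _%:E)%E.
have X c : (t - u) `^ (c - 1) = (t - u) `^ c / (t - u).
  by rewrite powRB ?powRr1 ?(ltW tu0)// (gt_eqF tu0) implybT.
rewrite !X powRD ?(gt_eqF tu0) ?implybT//; field.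
by rewrite gt_eqF.
Qed.

(** Euler's formula.  Weighted by exp(-t) and integrated over t, the
    convolution of x_+^(a-1) and x_+^(b-1) splits by Tonelli into the product
    of the two Gamma integrals, while [tpow_convolution] evaluates it as
    B(a,b) t_+^(a+b-1). *)
Lemma gamma_erealM a b : (gamma_ereal a * gamma_ereal b = beta_ereal a b * gamma_ereal (a + b))%E.
Proof.
have mg c : measurable_fun [set: R] (fun x : R => tpow c x * expR (- x)).
  apply: measurable_funM; first exact: measurable_tpow.
  by apply: measurableT_comp => //.
have kg0 c x : (0 <= (tpow c x * expR (- x))%:E)%E.
  by rewrite lee_fin mulr_ge0 ?tpow_ge0 ?expR_ge0.
have mgE c : measurable_fun [set: R] (fun x : R => (tpow c x * expR (- x))%:E).
  exact/measurable_EFinP.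
have gZl c k : (0 <= k -> \int[mu]_x (k * (tpow c x * expR (- x))%:E) = k * gamma_ereal c)%E.
  by move=> k0; exact: (ge0_integralZl mu measurableT (mgE c) (fun x _ => kg0 c x) k0).
pose F (z : R * R) := (tpow a (z.2 - z.1) * tpow b z.1 * expR (- z.2))%:E.
have mF : measurable_fun [set: R * R] F.
  apply/measurable_EFinP; apply: measurable_funM; first apply: measurable_funM.
  - by apply: measurable_tpow_comp; exact: measurable_funB.
  - exact: measurable_tpow_comp.
  - by apply: measurableT_comp => //; exact: measurableT_comp.
have F0 z : (0 <= F z)%E.
  by rewrite lee_fin !mulr_ge0 ?tpow_ge0 ?expR_ge0.
have := @fubini_tonelli _ _ _ _ R mu mu F mF F0.
rewrite /F/= => H.
transitivity (\int[mu]_y \int[mu]_t (tpow a (t - y) * tpow b y * expR (- t))%:E)%E.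
  rewrite -(gZl b _ (gamma_ereal_ge0 a)).
  apply: eq_integral => y _.
  have GA : gamma_ereal a = (\int[mu]_t (tpow a (t - y) * expR (- (t - y)))%:E)%E.
    have := ge0_integral_affine (- y) ltr01 (mgE a) (kg0 a); rewrite mul1e => GA.
    by rewrite [LHS]GA; apply: eq_integral => t _; rewrite mul1r.
  have mGA : measurable_fun [set: R] (fun t : R => (tpow a (t - y) * expR (- (t - y)))%:E).
    by apply: (measurableT_comp (mgE a)); exact: measurable_funB.
  rewrite GA; apply: etrans; first by
    apply/esym; exact: (ge0_integralZr mu measurableT mGA (fun x _ => kg0 a (x - y)) (kg0 b y)).
  apply: eq_integral => t _; rewrite -EFinM; congr EFin.
  rewrite opprB expRD.
  have E : expR y * expR (- y) = 1 by rewrite -expRD subrr expR0.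
  by rewrite -[RHS]mulr1 -E; ring.
rewrite H -(gZl (a + b) _ (beta_ereal_ge0 a b)).
apply: eq_integral => t _.
have CE : (beta_ereal a b * (tpow (a + b) t)%:E = \int[mu]_s (tpow a (t - s) * tpow b s)%:E)%E.
  have := tpow_convolution a b t 0; rewrite subr0 => <-.
  by apply: eq_integral => s _; rewrite !subr0.
have mC : measurable_fun [set: R] (fun s : R => (tpow a (t - s) * tpow b s)%:E).
  apply/measurable_EFinP; have := measurable_tpowM a b t 0.
  by under eq_fun do rewrite subr0.
have C0 s : (0 <= (tpow a (t - s) * tpow b s)%:E)%E by rewrite lee_fin mulr_ge0 ?tpow_ge0.
have e0 : (0 <= (expR (- t))%:E)%E by rewrite lee_fin expR_ge0.
rewrite EFinM muleA CE.
exact: (ge0_integralZr mu measurableT mC (fun s _ => C0 s) e0).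
Qed.

End Kernel.

(** * Finiteness and positivity of the Euler integrals *)

Section GammaBeta.
Context {R : realType}.
Local Notation mu := (@lebesgue_measure R).
Implicit Types (a b c d t u x : R).

Lemma gamma_ereal_def a : gamma_ereal a = (\int[mu]_x (tpow a x * expR (- x))%:E)%E.
Proof. by []. Qed.

Lemma beta_ereal_def a b : beta_ereal a b = (\int[mu]_x (tpow a (1 - x) * tpow b x)%:E)%E.
Proof. by []. Qed.

Local Opaque gamma_ereal beta_ereal.

(** Otherwise f would vanish almost everywhere, in particular on ]0, 1[. *)
Lemma ge0_integral_gt0 (f : R -> R) : measurable_fun [set: R] f ->
  (forall x, 0 <= f x) -> (forall x, 0 < x < 1 -> 0 < f x) ->
  (0 < \int[mu]_x (f x)%:E)%E.
Proof.
move=> mf f0 f1; rewrite lt_neqAle integral_ge0 ?andbT; last first.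
  by move=> x _; rewrite lee_fin.
apply/eqP => /esym I0.
have mfE : measurable_fun [set: R] (EFin \o f) by exact/measurable_EFinP.
have [+ _] := ae_eq_integral_abs mu measurableT mfE.
under eq_integral do rewrite /= ger0_norm//.
move=> /(_ I0) [N [mN N0 sN]].
have : (mu `]0%R, 1%R[%classic <= mu N)%E.
  apply: le_measure; rewrite ?inE//.
  move=> x /=; rewrite in_itv/= => x01; apply: sN => /= /(_ I) [fx0].
  by have := f1 x x01; rewrite fx0 ltxx.
by rewrite N0 lebesgue_measure_itv/= lte_fin ltr01 oppr0 adde0 lee_fin ler10.
Qed.

Lemma beta_ereal_gt0 a b : (0 < beta_ereal a b :> \bar R)%E.
Proof.
rewrite beta_ereal_def; apply: ge0_integral_gt0.
- have := @measurable_tpowM R a b 1 0.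
  by under eq_fun do rewrite subr0.
- by move=> x; rewrite mulr_ge0 ?tpow_ge0.
- by move=> x /andP[x0 x1]; rewrite mulr_gt0 ?tpow_gt0 ?subr_gt0.
Qed.

Lemma measurable_gamma a : measurable_fun [set: R] (fun x : R => tpow a x * expR (- x)).
Proof.
apply: measurable_funM; first exact: measurable_tpow.
by apply: measurableT_comp => //.
Qed.

Lemma gamma_ereal_gt0 a : (0 < gamma_ereal a :> \bar R)%E.
Proof.
rewrite gamma_ereal_def; apply: ge0_integral_gt0.
- exact: measurable_gamma.
- by move=> x; rewrite mulr_ge0 ?tpow_ge0 ?expR_ge0.
- by move=> x /andP[x0 x1]; rewrite mulr_gt0 ?tpow_gt0 ?expR_gt0.
Qed.

Lemma powR_integral_away0 a (e : R) : 0 < a -> 0 < e <= 1 ->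
  (\int[mu]_(x in `[e, 1%R]) (tpow a x)%:E <= a^-1%:E)%E.
Proof.
move=> a0 /andP[e0]; rewrite le_eqVlt => /predU1P[->|e1].
  by rewrite set_itv1 integral_set1 lee_fin invr_ge0 ltW.
have pos x : e <= x -> x \in `]0, +oo[.
  by move=> ex; rewrite in_itv/= andbT (lt_le_trans e0).
pose F x : R := a^-1 * x `^ a.
have dF x : e <= x -> is_derive x 1 F (x `^ (a - 1)).
  move=> ex.
  have H : is_derive x 1 (@powR R ^~ a) (a * x `^ (a - 1)).
    split; first exact/derivable_powR/pos.
    by rewrite -derive1E powR_derive1// pos.
  apply: is_derive_eq.
  by rewrite /= /GRing.scale/= mulrA mulVf ?mul1r// gt_eqF.
have cont g : (forall x, e <= x -> derivable g x 1) -> {within `[e, 1], continuous g}.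
  by move=> dg; apply: derivable_within_continuous => x; rewrite in_itv/= => /andP[/dg].
have -> : (\int[mu]_(x in `[e, 1%R]) (tpow a x)%:E = \int[mu]_(x in `[e, 1%R]) (x `^ (a - 1))%:E)%E.
  apply: eq_integral => x; rewrite inE/= in_itv/= => /andP[ex _].
  by rewrite tpowE// (lt_le_trans e0).
rewrite (@continuous_FTC2 _ _ F)//.
- rewrite -EFinB lee_fin /F powR1 mulr1 gerBl mulr_ge0 ?powR_ge0// invr_ge0 ltW//.
- by apply: cont => x ex; exact/derivable_powR/pos.
- have /continuous_within_itvP : {within `[e, 1], continuous F}.
    by apply: cont => x ex; have := dF x ex => -[].
  move=> /(_ e1) [_ ? ?]; split => // x; rewrite in_itv/= => /andP[/ltW ex _].
  by have := dF x ex => -[].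
- move=> x; rewrite in_itv/= => /andP[/ltW ex _].
  by have := dF x ex => -[_ <-]; rewrite derive1E.
Qed.

(** The integrals over [1/(n+1), 1] increase to this one, and each is at most
    1/a by the fundamental theorem of calculus. *)
Lemma powR_integral_lty a : 0 < a -> (\int[mu]_(x in `]0%R, 1%R]) (tpow a x)%:E < +oo)%E.
Proof.
move=> a0.
pose F n : set R := `[n.+1%:R^-1, 1]%classic.
have FU : `]0, 1]%classic = \bigcup_n F n.
  apply/seteqP; split => x /=; rewrite in_itv/=.
    move=> /andP[x0 x1]; exists (Num.truncn x^-1) => //=.
    rewrite /F/= in_itv/= x1 andbT -[leRHS]invrK lef_pV2 ?posrE ?invr_gt0 ?ltr0n//.
    exact/ltW/truncnS_gt.
  move=> [n _]; rewrite /F/= in_itv/= => /andP[nx ->]; rewrite andbT.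
  by apply: lt_le_trans nx; rewrite invr_gt0 ltr0n.
rewrite FU (@le_lt_trans _ _ a^-1%:E)// ?ltry//.
have := @ge0_nondecreasing_set_cvg_integral _ (measurableTypeR R) R F (EFin \o tpow a) mu.
move=> /(_ _ _ _ _) H.
have {}H : (\int[mu]_(x in F i) (tpow a x)%:E @[i --> \oo] -->
         \int[mu]_(x in \bigcup_i F i) (tpow a x)%:E)%E.
  apply: H => //.
  - apply/nondecreasing_seqP => n; apply/subsetPset => x; rewrite /F/= !in_itv/= => /andP[nx ->].
    rewrite andbT (le_trans _ nx)// lef_pV2 ?posrE ?ltr0n// ler_nat//.
  - by move=> n; exact: measurable_itv.
  - by move=> n; apply/measurable_EFinP; apply: measurable_funTS; exact: measurable_tpow.
  - by move=> n x _; rewrite lee_fin tpow_ge0.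
rewrite -(cvg_lim _ H)//; apply: lime_le; first by apply/cvg_ex; eexists; exact: H.
near=> n; apply: powR_integral_away0 => //.
by rewrite invr_gt0 ltr0n/= invf_le1 ?ltr0n// ler1n.
Unshelve. all: by end_near. Qed.

Lemma gamma_ereal_lty_le1 a : 0 < a <= 1 -> (gamma_ereal a < +oo)%E.
Proof.
move=> /andP[a0 a1].
have mi : measurable_fun [set: R] (fun x : R => tpow a x * \1_`]0, 1]%classic x).
  apply: measurable_funM; first exact: measurable_tpow.
  exact: measurable_indic.
rewrite gamma_ereal_def.
apply: (@le_lt_trans _ _ (\int[mu]_x ((tpow a x * \1_`]0, 1]%classic x)%:E +
  (exponential_pdf 1 x)%:E))%E).
  apply: ge0_le_integral => //.
  - by move=> x _; rewrite lee_fin mulr_ge0 ?tpow_ge0 ?expR_ge0.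
  - by apply/measurable_EFinP; exact: measurable_gamma.
  - apply: emeasurable_funD; apply/measurable_EFinP => //.
    by apply: measurable_exponential_pdf.
  - move=> x _; rewrite -EFinD lee_fin.
    have [x0|x0] := leP x 0.
      by rewrite tpow_le0// !mul0r add0r exponential_pdf_ge0.
    have [x1|x1] := leP x 1.
      rewrite indicE mem_set ?mulr1/=; last by rewrite in_itv/= x0 x1.
      rewrite -[leLHS]addr0 lerD ?exponential_pdf_ge0//.
      by rewrite ler_piMr ?tpow_ge0// -expR0 ler_expR oppr_le0 ltW.
    rewrite -[leLHS]add0r lerD ?mulr_ge0 ?tpow_ge0//.
    rewrite exponential_pdfE ?(ltW x0)// mul1r mulN1r ler_piMl ?expR_ge0//.
    by rewrite tpowE// -[leRHS](powRr0 x) ler_powR ?(ltW x1)// subr_le0.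
rewrite ge0_integralD//; last 4 first.
- by move=> x _; rewrite lee_fin mulr_ge0 ?tpow_ge0.
- exact/measurable_EFinP.
- by move=> x _; rewrite lee_fin exponential_pdf_ge0.
- by apply/measurable_EFinP; exact: measurable_exponential_pdf.
rewrite integral_exponential_pdf// lte_add_pinfty ?ltry//.
rewrite (_ : (\int[mu]_x _)%E = (\int[mu]_(x in `]0%R, 1%R]) (tpow a x)%:E)%E).
  exact: powR_integral_lty.
rewrite [RHS]integral_mkcond; apply: eq_integral => x _.
by rewrite patchE indicE; case: ifP => _; rewrite ?mulr1 ?mulr0.
Qed.

(** By Euler's formula, Gamma(b/2)^2 = B(b/2, b/2) Gamma(b) with a positive
    Beta factor, so finiteness passes from b/2 to b; halving a often enough
    leads to an argument at most 1, where x^(a-1) and e^(-x) dominate the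
    integrand on the two sides of 1. *)
Lemma gamma_ereal_lty a : 0 < a -> (gamma_ereal a < +oo)%E.
Proof.
move=> a0.
have H (k : nat) b : 0 < b <= 2 ^+ k -> (gamma_ereal b < +oo)%E.
  elim: k b => [|k IH] b /andP[b0 bk].
    by apply: gamma_ereal_lty_le1; rewrite b0.
  have G2 : (gamma_ereal (b / 2) < +oo)%E.
    by apply: IH; rewrite divr_gt0//= ler_pdivrMr// -exprSr.
  have := gamma_erealM (b / 2) (b / 2); rewrite -splitr => E.
  rewrite ltNge leye_eq; apply/eqP => Gy; move: E; rewrite Gy.
  rewrite gt0_muley ?beta_ereal_gt0// => E.
  by have := lte_mul_pinfty (ltW (gamma_ereal_gt0 (b/2))) _ G2;
    rewrite E ltxx ge0_fin_numE ?gamma_ereal_ge0// => /(_ G2).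
apply: (H (Num.truncn a).+1); rewrite a0/=.
apply: (le_trans (ltW (truncnS_gt a))).
by rewrite -natrX ler_nat ltnW// ltn_expl.
Qed.

Lemma gamma_ereal_fin a : 0 < a -> gamma_ereal a \is a fin_num.
Proof. by move=> a0; rewrite ge0_fin_numE ?gamma_ereal_ge0 ?gamma_ereal_lty. Qed.

Lemma gamma_funE a : 0 < a -> (gamma_fun a)%:E = gamma_ereal a.
Proof.
move=> a0; rewrite -(fineK (gamma_ereal_fin a0)) gamma_ereal_def /gamma_fun /Rintegral.
congr (fine _)%:E.
rewrite integral_mkcond; apply: eq_integral => x _; rewrite patchE.
case: ifPn => [|/negP]; rewrite inE/= in_itv/= andbT => x0; first by rewrite tpowE.
by rewrite tpow_le0 ?mul0r// leNgt; apply/negP.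
Qed.

Lemma gamma_fun_gt0 a : 0 < a -> 0 < gamma_fun a.
Proof. by move=> a0; rewrite -lte_fin gamma_funE// gamma_ereal_gt0. Qed.

Lemma gamma_fun1 : gamma_fun (1 : R) = 1.
Proof.
apply: EFin_inj; rewrite gamma_funE// -(@integral_exponential_pdf R 1)//.
have pdfE : (fun x : R => (exponential_pdf 1 x)%:E) = (fun x : R => (expR (- x))%:E) \_ `[0%R, +oo[.
  apply/funext => x; rewrite /exponential_pdf !patchE; case: ifP => // _.
  by rewrite mul1r mulN1r.
rewrite pdfE -integral_mkcond -integral_itv_obnd_cbnd; last first.
  by apply/measurable_EFinP/measurableT_comp => //; exact: measurable_funTS.
rewrite integral_mkcond gamma_ereal_def; apply: eq_integral => x _; rewrite patchE.
case: ifPn => [|/negP]; rewrite inE/= in_itv/= andbT => x0.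
  by rewrite tpowE// subrr powRr0 mul1r.
by rewrite tpow_le0 ?mul0r// leNgt; apply/negP.
Qed.

(** Euler's formula again: an infinite B(a,b) would make the finite product
    Gamma(a) Gamma(b) infinite. *)
Lemma beta_ereal_fin a b : 0 < a -> 0 < b -> beta_ereal a b \is a fin_num.
Proof.
move=> a0 b0; rewrite ge0_fin_numE ?beta_ereal_ge0// ltNge leye_eq; apply/eqP => By.
have := gamma_erealM a b; rewrite By gt0_mulye ?gamma_ereal_gt0// => E.
have := gamma_ereal_fin a0; have := gamma_ereal_fin b0 => Gb Ga.
by have := fin_numM Ga Gb; rewrite E.
Qed.

Definition beta_real a b : R := fine (beta_ereal a b).

Lemma gamma_beta a b : 0 < a -> 0 < b ->
  gamma_fun a * gamma_fun b = beta_real a b * gamma_fun (a + b).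
Proof.
move=> a0 b0; have := gamma_erealM a b.
rewrite -(gamma_funE a0) -(gamma_funE b0) -(gamma_funE (addr_gt0 a0 b0)).
by rewrite -(fineK (beta_ereal_fin a0 b0)) -EFinM -EFinM => -[].
Qed.
End GammaBeta.

(** * The semigroup law for real functions *)

Section RealFractionalIntegral.
Context {R : realType}.
Local Notation mu := (@lebesgue_measure R).
Implicit Types (a b t : R) (g h : R -> R).
Local Opaque gamma_ereal beta_ereal.

Definition real_frac_int a g t : R :=
  (gamma_fun a)^-1 * \int[mu]_(s in `[0, t]) ((t - s) `^ (a - 1) * g s).

Lemma measurable_sub_tpow a t : measurable_fun [set: R] (fun s : R => tpow a (t - s)).
Proof. by apply: measurable_tpow_comp; exact: measurable_funB. Qed.

(** Cutting g off at T rather than at t makes the extended function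
    independent of t, so that the right-hand side is a convolution. *)
Lemma integral_tpowE a g t T : t <= T ->
  measurable_fun `]0, T] g ->
  (\int[mu]_(s in `[0%R, t]) ((t - s) `^ (a - 1) * g s)%:E =
   \int[mu]_s (tpow a (t - s) * (g \_ `]0%R, T]) s)%:E)%E.
Proof.
move=> tT mg.
have sub : `]0, t[ `<=` `]0, T].
  by move=> s /=; rewrite !in_itv/= => /andP[-> st]; exact: (le_trans (ltW st)).
rewrite integral_itv_bndoo; last first.
  apply/measurable_EFinP; apply: measurable_funM; last exact: measurable_funS mg.
  apply: measurable_funTS; apply: (measurableT_comp (measurable_powR _)).
  exact: measurable_funB.
rewrite integral_mkcond; apply: eq_integral => s _; rewrite patchE.
case: ifPn => [|/negP]; rewrite inE/= in_itv/= => st.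
  move/andP: st => [s0 st].
  rewrite patchE mem_set/= ?in_itv/= ?s0 ?(le_trans (ltW st))//.
  by rewrite tpowE ?subr_gt0.
rewrite patchE; case: ifPn => [|_]; last by rewrite mulr0.
rewrite inE/= in_itv/= => /andP[s0 _].
by rewrite tpow_le0 ?mul0r// subr_le0 leNgt; apply/negP => H; apply: st; rewrite s0.
Qed.

Lemma measurable_integral_param (f : R * R -> \bar R) : measurable_fun [set: R * R] f ->
  measurable_fun [set: R] (fun s : R => \int[mu]_u f (s, u))%E.
Proof.
move=> mf.
have -> : (fun s : R => \int[mu]_u f (s, u))%E =
    ((fun s : R => \int[mu]_u f^\+ (s, u)) \- (fun s => \int[mu]_u f^\- (s, u)))%E.
  apply/funext => s; rewrite [LHS]integralE/=.
  under eq_integral do rewrite funepos_comp/=.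
  by under [X in (_ - X)%E = _]eq_integral do rewrite funeneg_comp/=.
apply: emeasurable_funB.
  apply: (@measurable_fun_fubini_tonelli_F _ _ _ _ _ mu) => //.
  exact: measurable_funepos.
apply: (@measurable_fun_fubini_tonelli_F _ _ _ _ _ mu) => //.
exact: measurable_funeneg.
Qed.

(** For c >= 1 the kernel increases with its argument t - u, so on u > 0 it is
    at most t^(c-1). *)
Lemma integrable_tpow_shift c t (G : R -> R) : 1 <= c -> 0 <= t -> (forall u, u <= 0 -> G u = 0) ->
  mu.-integrable setT (EFin \o G) ->
  mu.-integrable setT (fun u : R => (tpow c (t - u) * G u)%:E).
Proof.
move=> c1 t0 G0 iG.
have mG : measurable_fun [set: R] G by apply/measurable_EFinP; exact: measurable_int iG.
apply: (le_integrable measurableT _ _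
  (integrableZl measurableT (t `^ (c - 1)) (integrable_norm iG))).
  by apply/measurable_EFinP; apply: measurable_funM => //; exact: measurable_sub_tpow.
move=> u _ /=; rewrite lee_fin [leRHS]ger0_norm ?mulr_ge0 ?powR_ge0//.
rewrite normrM (ger0_norm (tpow_ge0 _ _)).
have [u0|u0] := leP u 0; first by rewrite G0// normr0 !mulr0.
apply: ler_wpM2r => //; have [tu|tu] := leP t u.
  by rewrite tpow_le0 ?subr_le0// powR_ge0.
rewrite tpowE ?subr_gt0// ge0_ler_powR ?subr_ge0// ?nnegrE ?subr_ge0 ?(ltW tu)//.
by rewrite gerBl ltW.
Qed.

Lemma integrable_tpow_tpow a b t u : 0 < a -> 0 < b ->
  mu.-integrable setT (fun s : R => (tpow a (t - s) * tpow b (s - u))%:E).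
Proof.
move=> a0 b0.
apply/integrableP; split; first by apply/measurable_EFinP; exact: measurable_tpowM.
under eq_integral do rewrite /= ger0_norm ?mulr_ge0 ?tpow_ge0//.
by rewrite tpow_convolution -(fineK (beta_ereal_fin a0 b0)) -EFinM ltry.
Qed.

(** Up to the Gamma factors, the integrand of I^a (I^b G) (t) as a function
    of the two integration variables. *)
Definition tpow_tpow a b t (G : R -> R) (z : R * R) : \bar R :=
  (tpow a (t - z.1) * (tpow b (z.1 - z.2) * G z.2))%:E.

Lemma measurable_tpow_conv b (G : R -> R) : measurable_fun [set: R] G ->
  measurable_fun [set: R * R] (fun z : R * R => tpow b (z.1 - z.2) * G z.2).
Proof.
move=> mG; apply: measurable_funM; last exact: measurableT_comp.
by apply: measurable_tpow_comp; exact: measurable_funB.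
Qed.

Lemma measurable_tpow_tpow a b t (G : R -> R) : measurable_fun [set: R] G ->
  measurable_fun [set: R * R] (tpow_tpow a b t G).
Proof.
move=> mG; apply/measurable_EFinP; apply: measurable_funM; last exact: measurable_tpow_conv.
by apply: measurable_tpow_comp; exact: measurable_funB.
Qed.

Lemma integral_tpow_tpow a b t (G : R -> R) u : 0 < a -> 0 < b ->
  (\int[mu]_s tpow_tpow a b t G (s, u) =
   (fine (beta_ereal a b))%:E * (tpow (a + b) (t - u) * G u)%:E)%E.
Proof.
move=> a0 b0.
transitivity (\int[mu]_s ((tpow a (t - s) * tpow b (s - u))%:E * (G u)%:E))%E.
  by apply: eq_integral => s _; rewrite /tpow_tpow/= -EFinM mulrA.
rewrite (integralZr measurableT (integrable_tpow_tpow t u a0 b0)) tpow_convolution.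
by rewrite (fineK (beta_ereal_fin a0 b0)) EFinM muleA.
Qed.

(** Integrating the absolute value in s first gives a multiple of
    (t - u)_+^(a+b-1) |G u|, which is integrable because a + b >= 1. *)
Lemma integrable_tpow_tpow_prod a b t (G : R -> R) : 0 < a -> 0 < b -> 1 <= a + b -> 0 <= t ->
  (forall u, u <= 0 -> G u = 0) -> mu.-integrable setT (EFin \o G) ->
  (mu \x mu)%E.-integrable setT (tpow_tpow a b t G).
Proof.
move=> a0 b0 ab1 t0 G0 iG.
have mG : measurable_fun [set: R] G by apply/measurable_EFinP; exact: measurable_int iG.
have mF := measurable_tpow_tpow a b t mG.
apply/(@integrable21ltyP _ _ (measurableTypeR R) (measurableTypeR R) R mu mu _ mF).
have inner u : (\int[mu]_s `|tpow_tpow a b t G (s, u)| =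
    (fine (beta_ereal a b))%:E * `|(tpow (a + b) (t - u) * G u)%:E|)%E.
  rewrite -[X in (_ * X)%E]/((`|tpow (a + b) (t - u) * G u|)%:E).
  rewrite normrM (ger0_norm (tpow_ge0 _ _)).
  rewrite -(integral_tpow_tpow t (fun u => `|G u|))//; apply: eq_integral => s _ /=; congr EFin.
  by rewrite !normrM !(ger0_norm (tpow_ge0 _ _)).
under eq_integral do rewrite inner.
have /integrableP[mk H] := integrable_tpow_shift ab1 t0 G0 iG.
rewrite (ge0_integralZl mu measurableT).
- by rewrite lte_mul_pinfty ?lee_fin ?fine_ge0 ?beta_ereal_ge0.
- exact: measurableT_comp.
- by [].
- by rewrite lee_fin fine_ge0// beta_ereal_ge0.
Qed.

(** Where the integral diverges this has the conventional value of [fine];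
    [integral_tpow_conv] shows that this does not affect a further
    integration. *)
Definition tpow_conv b (G : R -> R) (s : R) : R :=
  fine (\int[mu]_u (tpow b (s - u) * G u)%:E)%E.

Lemma measurable_tpow_conv_fun b (G : R -> R) : measurable_fun [set: R] G ->
  measurable_fun [set: R] (tpow_conv b G).
Proof.
move=> mG; apply: measurableT_comp => //.
apply: (@measurable_integral_param (fun z => (tpow b (z.1 - z.2) * G z.2)%:E)).
by apply/measurable_EFinP; exact: measurable_tpow_conv.
Qed.

(** By Fubini, for almost every s the inner integral converges unless the
    outer kernel vanishes at s, and in the latter case both integrands
    are 0. *)
Lemma integral_tpow_conv a b t k (G : R -> R) :
  (mu \x mu)%E.-integrable setT (tpow_tpow a b t G) -> measurable_fun [set: R] G ->
  (\int[mu]_s (tpow a (t - s) * (k * tpow_conv b G s))%:E =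
   k%:E * \int[mu]_s \int[mu]_u tpow_tpow a b t G (s, u))%E.
Proof.
move=> iF mG; have mI := measurable_tpow_conv_fun b mG.
rewrite -(integralZl measurableT (integrable_fubini_F iF)).
apply: ae_eq_integral; first exact: measurableT.
- apply/measurable_EFinP; apply: measurable_funM; first exact: measurable_sub_tpow.
  by apply: measurable_funM => //; exact: measurable_cst.
- by apply: measurable_funeM; exact: (measurable_fubini_F iF).
have := ae_integrable1 iF; apply: filterS => s /= iFs _.
have [k0|k0] := eqVneq (tpow a (t - s)) 0.
  rewrite k0 mul0r /fubini_F integral0_eq ?mule0//.
  by move=> u _; rewrite /tpow_tpow/= k0 mul0r.
have iFs' : mu.-integrable setT (fun u : R => (tpow b (s - u) * G u)%:E).
  have := integrableZl measurableT (tpow a (t - s))^-1 iFs.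
  by apply: eq_integrable => // u _; rewrite /tpow_tpow/= -EFinM mulKf.
rewrite /fubini_F; have -> : (\int[mu]_u tpow_tpow a b t G (s, u) =
    (tpow a (t - s))%:E * \int[mu]_u (tpow b (s - u) * G u)%:E)%E.
  by rewrite -(integralZl measurableT iFs'); apply: eq_integral => u _.
rewrite -(fineK (integrable_fin_num measurableT iFs')) -/(tpow_conv b G s) -!EFinM.
by congr EFin; rewrite mulrCA.
Qed.

Lemma integral_tpow_ext a b t T (G h : R -> R) : t <= T ->
  (forall u, u <= 0 -> G u = 0) -> measurable_fun [set: R] G ->
  (forall s, 0 < s <= T -> h s = (gamma_fun b)^-1 * tpow_conv b G s) ->
  (\int[mu]_(s in `[0%R, t]) ((t - s) `^ (a - 1) * h s)%:E =
   \int[mu]_s (tpow a (t - s) * ((gamma_fun b)^-1 * tpow_conv b G s))%:E)%E.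
Proof.
move=> tT G0 mG hE; have mI := measurable_tpow_conv_fun b mG.
have mh : measurable_fun `]0, T] h.
  have : measurable_fun `]0, T] (fun s => (gamma_fun b)^-1 * tpow_conv b G s).
    by apply: measurable_funTS; apply: measurable_funM => //; exact: measurable_cst.
  by apply: eq_measurable_fun => s; rewrite inE/= in_itv/= => /hE ->.
rewrite (integral_tpowE _ tT mh); apply: eq_integral => s _; congr EFin.
rewrite patchE; case: ifPn => [|/negP]; rewrite inE/= in_itv/= => sT.
  by rewrite (hE _ sT).
have [s0|s0] := leP s 0.
  rewrite /tpow_conv integral0_eq ?mulr0// => u _; congr EFin.
  have [u0|u0] := leP u 0; first by rewrite (G0 _ u0) mulr0.
  by rewrite (tpow_le0 b) ?mul0r// subr_le0 ltW// (le_lt_trans s0).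
have ts : t <= s.
  rewrite (le_trans tT)// ltW// ltNge; apply/negP => H; apply: sT.
  by rewrite s0 H.
by rewrite (tpow_le0 a) ?mul0r// subr_le0.
Qed.

(** Fubini reduces the iterated integral to [tpow_convolution], and the Gamma
    factors combine by Euler's formula.  Since a + b >= 1 the resulting kernel
    is bounded, so the identity holds at every t although I^b g may be defined
    almost everywhere only.  The function h is tied to I^b g on ]0, T] alone,
    which is where a Caputo equation is required to hold. *)
Lemma real_frac_int_semigroup a b T g h : 0 < a -> 0 < b -> 1 <= a + b ->
  mu.-integrable `[0, T] (EFin \o g) ->
  (forall s, 0 < s <= T -> h s = real_frac_int b g s) ->
  forall t, 0 <= t <= T -> real_frac_int a h t = real_frac_int (a + b) g t.
Proof.
move=> a0 b0 ab1 ig hE t /andP[t0 tT].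
pose G : R -> R := g \_ `]0, T].
have sub0T : `]0, T] `<=` `[0, T] by move=> x /=; rewrite !in_itv/= => /andP[/ltW -> ->].
have mg : measurable_fun `]0, T] g.
  by apply/measurable_EFinP; apply: measurable_funS (measurable_int _ ig).
have G0 u : u <= 0 -> G u = 0.
  move=> u0; rewrite /G patchE; case: ifPn => //; rewrite inE/= in_itv/=.
  by rewrite ltNge u0.
have iG : mu.-integrable setT (EFin \o G).
  have H : mu.-integrable `]0, T] (EFin \o g) by exact: integrableS ig.
  have mI : measurable (`]0, T]%classic : set (measurableTypeR R)) by exact: measurable_itv.
  have := (@integrable_mkcond _ (measurableTypeR R) R mu _ (EFin \o g) mI).1 H.
  by rewrite restrict_EFin.
have mG : measurable_fun [set: R] G by apply/measurable_EFinP; exact: measurable_int iG.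
have hconv s : 0 < s <= T -> h s = (gamma_fun b)^-1 * tpow_conv b G s.
  move=> sT; rewrite (hE s sT) /real_frac_int /tpow_conv /Rintegral; congr (_ * fine _).
  by apply: integral_tpowE => //; case/andP: sT.
have iF := integrable_tpow_tpow_prod a0 b0 ab1 t0 G0 iG.
have ikG := integrable_tpow_shift ab1 t0 G0 iG.
rewrite /real_frac_int /Rintegral (integral_tpow_ext a tT G0 mG hconv) (integral_tpow_conv _ iF mG).
rewrite (Fubini iF).
under [X in (_ * X)%E]eq_integral do rewrite (integral_tpow_tpow _ _ _ a0 b0).
rewrite (integralZl measurableT ikG) (integral_tpowE _ tT mg) -/G.
have := fineK (integrable_fin_num measurableT ikG).
set I := (\int[mu]_u _)%E => <-; move: (fine I) => J; rewrite -!EFinM/=.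
have := gamma_beta a0 b0; rewrite /beta_real.
have := gamma_fun_gt0 a0; have := gamma_fun_gt0 b0; have := gamma_fun_gt0 (addr_gt0 a0 b0).
move: (fine (beta_ereal a b)) (gamma_fun a) (gamma_fun b) (gamma_fun (a + b))
  => B x y z z0 y0 x0 xyB.
have -> : B = x * y / z by rewrite xyB mulfK// gt_eqF.
by field; rewrite !gt_eqF.
Qed.

End RealFractionalIntegral.

(** * A real-valued norm on the complex numbers *)

Section ComplexNorm.
Context {R : realType}.
Implicit Types z w : R[i].

(** Integrals of complex functions are taken part by part, and the modulus of
    such an integral is awkward to bound.  This norm is real-valued,
    submultiplicative, and bounded as soon as the two parts are. *)
Definition l1norm z : R := `|complex.Re z| + `|complex.Im z|.

Lemma l1norm_ge0 z : 0 <= l1norm z. Proof. by rewrite addr_ge0. Qed.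

Lemma l1norm0 : l1norm 0 = 0. Proof. by rewrite /l1norm/= normr0 addr0. Qed.

Lemma l1normD z w : l1norm (z + w) <= l1norm z + l1norm w.
Proof.
case: z w => [a b] [c d]; rewrite /l1norm/= addrACA.
by rewrite lerD ?ler_normD.
Qed.

Lemma l1normN z : l1norm (- z) = l1norm z.
Proof. by case: z => a b; rewrite /l1norm/= !normrN. Qed.

Lemma l1normB z w : l1norm (z - w) <= l1norm z + l1norm w.
Proof. by rewrite -(l1normN w) l1normD. Qed.

Lemma l1normM z w : l1norm (z * w) <= l1norm z * l1norm w.
Proof.
case: z w => [a b] [c d]; rewrite /l1norm/=.
have -> : (`|a| + `|b|) * (`|c| + `|d|) = (`|a * c| + `|b * d|) + (`|a * d| + `|b * c|).
  by rewrite !normrM; ring.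
by rewrite lerD// ?ler_normD// (le_trans (ler_normB _ _)).
Qed.

Lemma l1norm_sum I (s : seq I) (P : pred I) (F : I -> R[i]) :
  l1norm (\sum_(i <- s | P i) F i) <= \sum_(i <- s | P i) l1norm (F i).
Proof.
elim/big_ind2 : _ => [|x a y b xa yb|//]; first by rewrite l1norm0.
by rewrite (le_trans (l1normD _ _))// lerD.
Qed.

Lemma l1norm_realM (x : R) z : l1norm (x%:C * z) = `|x| * l1norm z.
Proof. by case: z => a b; rewrite /l1norm/= !mul0r subr0 addr0 !normrM mulrDr. Qed.

Lemma normc_le_l1norm z : `|z| <= (l1norm z)%:C.
Proof.
case: z => a b; rewrite normc_def lecR /l1norm/= -[leRHS]ger0_norm ?addr_ge0//.
rewrite -sqrtr_sqr ler_wsqrtr// sqrrD !real_normK ?num_real// lerD2r lerDl.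
by rewrite mulrn_wge0 ?mulr_ge0.
Qed.

Lemma Re_le_normc z : `|complex.Re z|%:C <= `|z|.
Proof.
case: z => a b; rewrite normc_def lecR/= -sqrtr_sqr ler_wsqrtr//.
by rewrite lerDl sqr_ge0.
Qed.

Lemma Im_le_normc z : `|complex.Im z|%:C <= `|z|.
Proof.
case: z => a b; rewrite normc_def lecR/= -sqrtr_sqr ler_wsqrtr//.
by rewrite lerDr sqr_ge0.
Qed.

(** The topology of R[i]^o comes from the modulus, which lies between the
    absolute value of each part and their sum. *)
Lemma cvg_l1normP {T : Type} {F : set_system T} {FF : Filter F} (f : T -> R[i]) (l : R[i]) :
  (f : T -> R[i]^o) @ F --> (l : R[i]^o) <->
  forall e : R, 0 < e -> \forall x \near F, l1norm (l - f x) < e.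
Proof.
split => [/cvgrPdist_lt fl e e0|H].
- have e20 : (0 : R[i]) < (e / 2)%:C by rewrite ltcR divr_gt0.
  have := fl _ e20; apply: filterS => x lt.
  have R1 := le_lt_trans (Re_le_normc _) lt; have I1 := le_lt_trans (Im_le_normc _) lt.
  by rewrite /l1norm (splitr e) ltrD// -ltcR.
- apply/cvgrPdist_lt => e; case: e => e1 e2 e0.
  have := e0; rewrite ltcE/= => /andP[/eqP e2E e10].
  have := H _ e10; apply: filterS => x lt.
  apply: (le_lt_trans (normc_le_l1norm _)).
  by rewrite ltcE/= -e2E eqxx.
Qed.

Lemma cvg_ReIm {T : Type} {F : set_system T} {FF : Filter F} (f : T -> R[i]) (l : R[i]) :
  (f : T -> R[i]^o) @ F --> (l : R[i]^o) ->
  (fun x => complex.Re (f x)) @ F --> complex.Re l /\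
  (fun x => complex.Im (f x)) @ F --> complex.Im l.
Proof.
move=> /cvg_l1normP H; split; apply/cvgrPdist_lt => e e0; have := H _ e0;
  apply: filterS => x; rewrite /l1norm; case: l {H} => a b; case: (f x) => c d /=;
  apply: le_lt_trans.
  by rewrite lerDl.
by rewrite lerDr.
Qed.
End ComplexNorm.

(** * Fractional integrals of bounded measurable functions *)

Section BoundedMeasurable.
Context {R : realType}.
Local Notation mu := (@lebesgue_measure R).
Implicit Types (a b t T : R) (g h : R -> R).
Local Opaque gamma_ereal beta_ereal.

(** A class of integrands on which I^a is linear for all a > 0: it contains the
    continuous functions and the powers with exponent >= 0, and it is closed
    under products. *)
Definition bmeas t g : Prop := measurable_fun `[0, t] g /\
  exists M : R, forall s, 0 <= s <= t -> `|g s| <= M.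

Lemma bmeasS t T g : t <= T -> bmeas T g -> bmeas t g.
Proof.
move=> tT [mg [M gM]]; split.
  by apply: measurable_funS mg => //; apply: subset_itvl; rewrite bnd_simp.
by exists M => s /andP[s0 st]; rewrite gM// s0 (le_trans st).
Qed.

Lemma eq_bmeas t g h : (forall s, 0 <= s <= t -> g s = h s) -> bmeas t g -> bmeas t h.
Proof.
move=> gh [mg [M gM]]; split; last by exists M => s st; rewrite -gh// gM.
by apply: eq_measurable_fun mg => s; rewrite inE/= in_itv/= => /gh.
Qed.

Lemma bmeas_cst t c : bmeas t (fun=> c).
Proof. by split; [exact: measurable_cst|exists `|c|]. Qed.

Lemma bmeasD t g h : bmeas t g -> bmeas t h -> bmeas t (fun s => g s + h s).
Proof.
move=> [mg [M gM]] [mh [N hN]]; split; first exact: measurable_funD.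
by exists (M + N) => s st; rewrite (le_trans (ler_normD _ _))// lerD ?gM ?hN.
Qed.

Lemma bmeasM t g h : bmeas t g -> bmeas t h -> bmeas t (fun s => g s * h s).
Proof.
move=> [mg [M gM]] [mh [N hN]]; split; first exact: measurable_funM.
by exists (M * N) => s st; rewrite normrM ler_pM ?gM ?hN.
Qed.

Lemma bmeasN t g : bmeas t g -> bmeas t (fun s => - g s).
Proof.
move=> [mg [M gM]]; split; first exact: measurable_funN.
by exists M => s st; rewrite normrN gM.
Qed.

Lemma bmeas_powR t b : 0 <= b -> bmeas t (fun s => s `^ b).
Proof.
move=> b0; split; first by apply: measurable_funTS; exact: measurable_powR.
exists (t `^ b) => s /andP[s0 st]; rewrite ger0_norm ?powR_ge0//.
by rewrite ge0_ler_powR// nnegrE// (le_trans s0).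
Qed.

Lemma bmeas_continuous T g : 0 <= T -> {within `[0, T], continuous g} -> bmeas T g.
Proof.
move=> T0 cg; split; first exact: subspace_continuous_measurable_fun.
have [c _ cM] := EVT_max T0 cg; have [d _ dM] := EVT_min T0 cg.
exists (Num.max `|g c| `|g d|) => s sT.
have st : s \in `[0, T] by rewrite in_itv.
have := cM _ st; have := dM _ st; rewrite le_max => ds sc.
have [g0|g0] := leP 0 (g s).
  by rewrite ger0_norm// (le_trans sc)// ler_norm.
by apply/orP; right; rewrite ltr0_norm// ler0_norm ?(le_trans ds) ?(ltW g0)// lerN2.
Qed.

Lemma integral_tpow_powR a b t : 0 < a -> 0 <= b -> 0 <= t ->
  (\int[mu]_(s in `[0%R, t]) ((t - s) `^ (a - 1) * s `^ b)%:E =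
   beta_ereal a (b + 1) * (t `^ (a + b))%:E)%E.
Proof.
move=> a0 b0 t0.
rewrite (@integral_tpowE _ a _ t t)//; last first.
  by apply: measurable_funTS; exact: measurable_powR.
have -> : (t `^ (a + b))%:E = (tpow (a + (b + 1)) (t - 0))%:E.
  rewrite subr0 /tpow addrA addrK; case: ltP => // t0'.
  by rewrite (le_anti (introT andP (conj t0' t0))) powR0// gt_eqF// ltr_pwDl.
rewrite -tpow_convolution; apply: eq_integral => s _; congr EFin.
rewrite patchE subr0; case: ifPn => [|/negP]; rewrite inE/= in_itv/= => st.
  by move/andP: st => [s0 _]; rewrite (tpowE _ s0) addrK.
have [s0|s0] := leP s 0; first by rewrite (tpow_le0 _ s0).
have [ts|ts] := leP t s; first by rewrite tpow_le0 ?mul0r// subr_le0.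
by exfalso; apply: st; rewrite s0 ltW.
Qed.

Lemma integrable_tpow_bmeas a t g : 0 < a -> 0 <= t -> bmeas t g ->
  mu.-integrable `[0, t] (fun s : R => ((t - s) `^ (a - 1) * g s)%:E).
Proof.
move=> a0 t0 [mg [M gM]].
have mI : measurable (`[0, t]%classic : set (measurableTypeR R)) by exact: measurable_itv.
have mk : measurable_fun `[0, t] (fun s : R => (t - s) `^ (a - 1)).
  apply: measurable_funTS; apply: (measurableT_comp (measurable_powR _)).
  exact: measurable_funB.
have ik : mu.-integrable `[0, t] (fun s : R => ((t - s) `^ (a - 1))%:E).
  apply/integrableP; split; first exact/measurable_EFinP.
  have -> : (\int[mu]_(s in `[0%R, t]) `|((t - s) `^ (a - 1))%:E| =
      \int[mu]_(s in `[0%R, t]) ((t - s) `^ (a - 1) * s `^ 0)%:E)%E.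
    by apply: eq_integral => s _; rewrite powRr0 mulr1/= ger0_norm ?powR_ge0.
  rewrite (integral_tpow_powR a0 (lexx 0) t0) add0r -(fineK (beta_ereal_fin a0 ltr01)).
  by rewrite -EFinM ltry.
have ik' := integrableZl mI M ik.
apply: (le_integrable mI _ _ ik').
  by apply/measurable_EFinP; exact: measurable_funM.
move=> s /=; rewrite in_itv/= => st; rewrite lee_fin !normrM mulrC.
by rewrite ler_wpM2r// (le_trans (gM _ st))// ler_norm.
Qed.

(** I^a s^b = frac_int_coef a b s^(a+b).  The value is
    Gamma(b+1) / Gamma(a+b+1), written as a Beta quotient because that form
    shows how it varies with b. *)
Definition frac_int_coef a b : R := beta_real a (b + 1) / gamma_fun a.

Lemma frac_int_coef_ge0 a b : 0 < a -> 0 <= frac_int_coef a b.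
Proof.
move=> a0; rewrite mulr_ge0 ?invr_ge0 ?(ltW (gamma_fun_gt0 a0))//.
by rewrite fine_ge0// beta_ereal_ge0.
Qed.

(** On ]0, 1[ the integrand of B(a, b+1) decreases as b grows. *)
Lemma frac_int_coef_le a b : 0 < a -> 0 <= b -> frac_int_coef a b <= frac_int_coef a 0.
Proof.
move=> a0 b0; rewrite ler_wpM2r ?invr_ge0 ?(ltW (gamma_fun_gt0 a0))//.
rewrite add0r -lee_fin !fineK ?beta_ereal_fin ?ltr_wpDl//.
have mm c : measurable_fun [set: R] (fun s : R => (tpow a (1 - s) * tpow c s)%:E).
  apply/measurable_EFinP; have := @measurable_tpowM R a c 1 0.
  by under eq_fun do rewrite subr0.
rewrite !beta_ereal_def; apply: ge0_le_integral => //.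
- by move=> x _; rewrite lee_fin mulr_ge0 ?tpow_ge0.
- exact: mm.
- exact: mm.
- move=> x _; rewrite lee_fin.
  have [x0|x0] := leP x 0; first by rewrite !(tpow_le0 _ x0) !mulr0.
  have [x1|x1] := leP 1 x; first by rewrite !(@tpow_le0 _ a) ?mul0r// subr_le0.
  rewrite ler_wpM2l ?tpow_ge0// !tpowE// addrK subrr.
  by rewrite ger_powR// x0 ltW.
Qed.

Lemma real_frac_int_powR a b t : 0 < a -> 0 <= b -> 0 <= t ->
  real_frac_int a (fun s => s `^ b) t = frac_int_coef a b * t `^ (a + b).
Proof.
move=> a0 b0 t0; rewrite /real_frac_int /Rintegral integral_tpow_powR//.
by rewrite fineM ?beta_ereal_fin ?ltr_wpDl//= /frac_int_coef /beta_real; ring.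
Qed.

Lemma real_frac_intD a t g h : 0 < a -> 0 <= t -> bmeas t g -> bmeas t h ->
  real_frac_int a (fun s => g s + h s) t = real_frac_int a g t + real_frac_int a h t.
Proof.
move=> a0 t0 bg bh; rewrite /real_frac_int -mulrDr -RintegralD//; last 2 first.
  exact: integrable_tpow_bmeas.
  exact: integrable_tpow_bmeas.
by congr (_ * _); apply: eq_Rintegral => s _; rewrite mulrDr.
Qed.

Lemma real_frac_intZ a t c g : 0 < a -> 0 <= t -> bmeas t g ->
  real_frac_int a (fun s => c * g s) t = c * real_frac_int a g t.
Proof.
move=> a0 t0 bg; rewrite /real_frac_int mulrCA.
rewrite -(@RintegralZl _ (measurableTypeR R) R mu _
  (fun s => (t - s) `^ (a - 1) * g s) c)//; last first.
  exact: integrable_tpow_bmeas.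
by congr (_ * _); apply: eq_Rintegral => s _; rewrite mulrCA.
Qed.

Lemma eq_real_frac_int a t g h : (forall s, 0 <= s <= t -> g s = h s) ->
  real_frac_int a g t = real_frac_int a h t.
Proof.
move=> gh; congr (_ * _); apply: eq_Rintegral => s; rewrite inE/= in_itv/=.
by move=> /gh ->.
Qed.

Lemma real_frac_int_bound a t g M : 0 < a -> 0 <= t -> bmeas t g ->
  (forall s, 0 <= s <= t -> `|g s| <= M) ->
  `|real_frac_int a g t| <= frac_int_coef a 0 * t `^ a * M.
Proof.
move=> a0 t0 bg gM.
have M0 : 0 <= M by rewrite (le_trans _ (gM 0 _))// lexx.
have := real_frac_int_powR a0 (lexx 0) t0; rewrite addr0 => <-.
rewrite mulrC -real_frac_intZ//; last exact: bmeas_powR.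
rewrite /real_frac_int normrM ger0_norm ?invr_ge0 ?(ltW (gamma_fun_gt0 a0))//.
rewrite ler_wpM2l ?invr_ge0 ?(ltW (gamma_fun_gt0 a0))//.
have ig := integrable_tpow_bmeas a0 t0 bg.
apply: (le_trans (le_normr_Rintegral _ ig)) => //.
apply: le_Rintegral => //.
- exact: (integrable_norm ig).
- apply: integrable_tpow_bmeas => //; apply: bmeasM; first exact: bmeas_cst.
  exact: bmeas_powR.
- move=> s /=; rewrite in_itv/= => st.
  by rewrite normrM ger0_norm ?powR_ge0// powRr0 mulr1 ler_wpM2l ?powR_ge0// gM.
Qed.

End BoundedMeasurable.

(** * Complex fractional integrals and the fundamental theorem of calculus *)

Section ComplexFractionalIntegral.
Context {R : realType}.
Implicit Types (a b t T : R) (g h : R -> R[i]).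

Lemma frac_intE a g t : frac_int a g t =
  real_frac_int a (fun s => complex.Re (g s)) t +i* real_frac_int a (fun s => complex.Im (g s)) t.
Proof.
rewrite /frac_int /cintegral /real_frac_int.
have -> : (fun s => complex.Re (((t - s) `^ (a - 1))%:C * g s)) =
    (fun s => (t - s) `^ (a - 1) * complex.Re (g s)).
  by apply/funext => s; case: (g s) => x y /=; rewrite mul0r subr0.
have -> : (fun s => complex.Im (((t - s) `^ (a - 1))%:C * g s)) =
    (fun s => (t - s) `^ (a - 1) * complex.Im (g s)).
  by apply/funext => s; case: (g s) => x y /=; rewrite mul0r addr0.
by apply/eqP; rewrite eq_complex/= !mul0r subr0 addr0 !eqxx.
Qed.

Definition cbmeas t g :=
  bmeas t (fun s => complex.Re (g s)) /\ bmeas t (fun s => complex.Im (g s)).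

Lemma cbmeasS t T g : t <= T -> cbmeas T g -> cbmeas t g.
Proof. by move=> tT [? ?]; split; apply: bmeasS tT _. Qed.

Lemma cbmeas_cst t (c : R[i]) : cbmeas t (fun=> c).
Proof. by split; exact: bmeas_cst. Qed.

Lemma cbmeasD t g h : cbmeas t g -> cbmeas t h -> cbmeas t (fun s => g s + h s).
Proof.
move=> [g1 g2] [h1 h2]; split.
  apply: eq_bmeas (bmeasD g1 h1) => s _; by case: (g s) (h s) => [? ?] [? ?].
apply: eq_bmeas (bmeasD g2 h2) => s _; by case: (g s) (h s) => [? ?] [? ?].
Qed.

Lemma cbmeasM t g h : cbmeas t g -> cbmeas t h -> cbmeas t (fun s => g s * h s).
Proof.
move=> [g1 g2] [h1 h2]; split.
  apply: eq_bmeas (bmeasD (bmeasM g1 h1) (bmeasN (bmeasM g2 h2))) => s _.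
  by case: (g s) (h s) => [? ?] [? ?].
apply: eq_bmeas (bmeasD (bmeasM g1 h2) (bmeasM g2 h1)) => s _.
by case: (g s) (h s) => [? ?] [? ?].
Qed.

Lemma cbmeasB t g h : cbmeas t g -> cbmeas t h -> cbmeas t (fun s => g s - h s).
Proof.
move=> mg mh; have := cbmeasD mg (cbmeasM (cbmeas_cst t (-1)) mh).
by under eq_fun do rewrite mulN1r.
Qed.

Lemma cbmeas_sum t I (r : seq I) (P : pred I) (F : I -> R -> R[i]) :
  (forall i, cbmeas t (F i)) -> cbmeas t (fun s => \sum_(i <- r | P i) F i s).
Proof.
move=> mF; elim: r => [|i r IH].
  by under eq_fun do rewrite big_nil; exact: cbmeas_cst.
under eq_fun do rewrite big_cons; case: (P i) => //.
exact: cbmeasD.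
Qed.

Lemma cbmeas_powR t b : 0 <= b -> cbmeas t (fun s => (s `^ b)%:C).
Proof. by move=> b0; split => /=; [exact: bmeas_powR|exact: bmeas_cst]. Qed.

Lemma cbmeas_continuous T g : 0 <= T ->
  {within `[0, T], continuous (g : R -> R[i]^o)} -> cbmeas T g.
Proof.
move=> T0 cg; split; apply: bmeas_continuous => // x.
  by have [H _] := cvg_ReIm (cg x).
by have [_ H] := cvg_ReIm (cg x).
Qed.

Lemma cbmeas_bound t g : cbmeas t g ->
  exists M : R, 0 <= M /\ forall s, 0 <= s <= t -> l1norm (g s) <= M.
Proof.
move=> [[_ [M gM]] [_ [N gN]]]; exists (`|M| + `|N|); split; first by rewrite addr_ge0.
move=> s st; rewrite /l1norm lerD//; first by rewrite (le_trans (gM s st))// ler_norm.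
by rewrite (le_trans (gN s st))// ler_norm.
Qed.

Lemma eq_frac_int a t g h : (forall s, 0 <= s <= t -> g s = h s) ->
  frac_int a g t = frac_int a h t.
Proof.
by move=> gh; rewrite !frac_intE; congr (_ +i* _); apply: eq_real_frac_int => s st; rewrite gh.
Qed.

Lemma frac_intD a t g h : 0 < a -> 0 <= t -> cbmeas t g -> cbmeas t h ->
  frac_int a (fun s => g s + h s) t = frac_int a g t + frac_int a h t.
Proof.
move=> a0 t0 [g1 g2] [h1 h2]; rewrite !frac_intE/=.
have -> : (fun s => complex.Re (g s + h s)) = (fun s => complex.Re (g s) + complex.Re (h s)).
  by apply/funext => s; case: (g s) (h s) => [? ?] [? ?].
have -> : (fun s => complex.Im (g s + h s)) = (fun s => complex.Im (g s) + complex.Im (h s)).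
  by apply/funext => s; case: (g s) (h s) => [? ?] [? ?].
by rewrite !real_frac_intD.
Qed.

Lemma frac_intZ a t (c : R[i]) g : 0 < a -> 0 <= t -> cbmeas t g ->
  frac_int a (fun s => c * g s) t = c * frac_int a g t.
Proof.
move=> a0 t0 [g1 g2]; rewrite !frac_intE; case: c => x y.
have -> : (fun s => complex.Re ((x +i* y) * g s)) =
    (fun s => x * complex.Re (g s) + (- y) * complex.Im (g s)).
  by apply/funext => s; case: (g s) => ? ? /=; rewrite mulNr.
have -> : (fun s => complex.Im ((x +i* y) * g s)) =
    (fun s => x * complex.Im (g s) + y * complex.Re (g s)).
  by apply/funext => s; case: (g s) => ? ? /=.
have bZ k f : bmeas t f -> bmeas t (fun s => k * f s).
  by apply: bmeasM; exact: bmeas_cst.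
rewrite !real_frac_intD ?real_frac_intZ//; do ?exact: bZ.
by apply/eqP; rewrite eq_complex/= mulNr !eqxx.
Qed.

Lemma frac_int_sum a t I (r : seq I) (P : pred I) (F : I -> R -> R[i]) :
  0 < a -> 0 <= t -> (forall i, cbmeas t (F i)) ->
  frac_int a (fun s => \sum_(i <- r | P i) F i s) t = \sum_(i <- r | P i) frac_int a (F i) t.
Proof.
move=> a0 t0 mF; elim: r => [|i r IH].
  rewrite big_nil -[RHS](mul0r (frac_int a (fun=> 0) t)) -frac_intZ//; last exact: cbmeas_cst.
  by apply: eq_frac_int => s _; rewrite big_nil mul0r.
rewrite big_cons -IH; case: ifP => Pi; last first.
  by apply: eq_frac_int => s _; rewrite big_cons Pi.
rewrite -frac_intD//; last exact: cbmeas_sum.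
by apply: eq_frac_int => s _; rewrite big_cons Pi.
Qed.

Lemma frac_int_powR a b t : 0 < a -> 0 <= b -> 0 <= t ->
  frac_int a (fun s => (s `^ b)%:C) t = (frac_int_coef a b)%:C * (t `^ (a + b))%:C.
Proof.
move=> a0 b0 t0; rewrite frac_intE/= real_frac_int_powR//.
have -> : real_frac_int a (fun _ => 0) t = 0.
  rewrite -[RHS](mul0r (real_frac_int a (fun=> 0) t)) -real_frac_intZ//; last exact: bmeas_cst.
  by apply: eq_real_frac_int => s _; rewrite mul0r.
by rewrite -rmorphM.
Qed.

Lemma frac_int_bound a t g M : 0 < a -> 0 <= t -> cbmeas t g ->
  (forall s, 0 <= s <= t -> l1norm (g s) <= M) ->
  l1norm (frac_int a g t) <= 2 * frac_int_coef a 0 * t `^ a * M.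
Proof.
move=> a0 t0 [g1 g2] gM; rewrite frac_intE /l1norm/= -!mulrA mulr_natl mulr2n !mulrA.
rewrite lerD//; apply: real_frac_int_bound => // s st; apply: le_trans (gM s st).
  by rewrite /l1norm lerDl.
by rewrite /l1norm lerDr.
Qed.

End ComplexFractionalIntegral.

Section FTC.
Context {R : realType}.
Local Notation mu := (@lebesgue_measure R).
Implicit Types (T t : R).

(** The epsilon-delta form of [has_derivative_on] for real functions; the
    restriction of s to [0, T] makes it one-sided at the end points. *)
Definition derivative_on T (d d' : R -> R) := forall t, 0 <= t <= T -> forall e, 0 < e ->
  exists2 r, 0 < r & forall s, 0 <= s <= T -> s != t -> `|s - t| < r ->
    `|(d s - d t) / (s - t) - d' t| < e.

Lemma has_derivative_ReIm T (g dg : R -> R[i]) : has_derivative_on T g dg ->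
  derivative_on T (fun s => complex.Re (g s)) (fun s => complex.Re (dg s)) /\
  derivative_on T (fun s => complex.Im (g s)) (fun s => complex.Im (dg s)).
Proof.
move=> H.
have K t (tT : 0 <= t <= T) e : 0 < e -> exists2 r, 0 < r &
    forall s, 0 <= s <= T -> s != t -> `|s - t| < r ->
    l1norm ((g s - g t) / (s - t)%:C - dg t) < e.
  move=> e0; have := H t; rewrite in_itv/= => /(_ tT) /cvg_l1normP /(_ e e0).
  rewrite near_withinE => -[r /= r0 Hr]; exists r => // s sT st str.
  rewrite -l1normN opprB; apply: Hr => //=.
  by rewrite /ball_/= distrC.
split => t tT e e0; have [r r0 Hr] := K t tT e e0; exists r => // s sT st str;
  have := Hr s sT st str; apply: le_lt_trans; rewrite -fmorphV /l1norm.
  have -> : (complex.Re (g s) - complex.Re (g t)) / (s - t) - complex.Re (dg t) =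
      complex.Re ((g s - g t) * (s - t)^-1%:C - dg t).
    by case: (g s) (g t) (dg t) => [? ?] [? ?] [? ?] /=; rewrite mulr0 subr0.
  by rewrite lerDl.
have -> : (complex.Im (g s) - complex.Im (g t)) / (s - t) - complex.Im (dg t) =
    complex.Im ((g s - g t) * (s - t)^-1%:C - dg t).
  by case: (g s) (g t) (dg t) => [? ?] [? ?] [? ?] /=; rewrite mulr0 add0r.
by rewrite lerDr.
Qed.

(** Near t the difference quotients are bounded by |d' t| + 1, so d is Lipschitz
    at t. *)
Lemma derivative_on_continuous T d d' : derivative_on T d d' -> {within `[0, T], continuous d}.
Proof.
move=> H; apply/subspace_continuousP => t /=; rewrite in_itv/= => tT.
apply/cvgrPdist_lt => e e0; rewrite near_withinE.
have [r r0 Hr] := H t tT 1 ltr01.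
have k0 : 0 < `|d' t| + 1 by rewrite ltr_wpDl.
have nb (r' : R) : 0 < r' -> \forall s \near t, `|s - t| < r'.
  by move=> r0'; apply/nbhs_ballP; exists r' => //= s; rewrite /ball/= distrC.
near=> s => /=; rewrite in_itv/= => sT.
have [->|st] := eqVneq s t; first by rewrite subrr normr0.
have sr : `|s - t| < r by near: s; exact: nb.
have se : `|s - t| < e / (`|d' t| + 1) by near: s; apply: nb; rewrite divr_gt0.
have := Hr s sT st sr.
set Q := (d s - d t) / (s - t) => HQ.
have -> : d t - d s = - (Q * (s - t)) by rewrite /Q divfK ?subr_eq0// opprB.
rewrite normrN normrM -ltr_pdivlMr; last by rewrite normr_gt0 subr_eq0.
have HQ2 : `|Q| < `|d' t| + 1.
  by rewrite -(subrK (d' t) Q) addrC (le_lt_trans (ler_normD _ _))// ltrD2l.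
apply: (lt_trans HQ2); rewrite ltr_pdivlMr ?normr_gt0 ?subr_eq0//.
by rewrite mulrC -ltr_pdivlMr.
Unshelve. all: by end_near. Qed.

Lemma derivative_on_is_derive T d d' t : derivative_on T d d' -> 0 < t < T ->
  is_derive t 1 d (d' t).
Proof.
move=> H /andP[t0 tT].
have C : h^-1 *: (d (h *: 1 + t) - d t) @[h --> 0^'] --> d' t.
  apply/cvgrPdist_lt => e e0.
  have [r r0 Hr] := H t (introT andP (conj (ltW t0) (ltW tT))) e e0.
  have hr (r' : R) : 0 < r' -> \forall h \near (0 : R)^', `|h| < r'.
    by move=> r0'; apply: dnbhs0_lt.
  near=> h.
  have h0 : h != 0 by near: h; exact: nbhs_dnbhs_neq.
  have h1 : `|h| < r by near: h; exact: hr.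
  have h2 : `|h| < t by near: h; exact: hr.
  have h3 : `|h| < T - t by near: h; apply: hr; rewrite subr_gt0.
  have := Hr (h + t); rewrite addrK distrC /GRing.scale/= mulr1 (mulrC h^-1); apply => //.
    move: h2 h3; rewrite !ltr_norml => /andP[? ?] /andP[? ?]; apply/andP; split; lra.
  by rewrite -subr_eq0 addrK.
by split; [apply/cvg_ex; exists (d' t)|exact: cvg_lim C].
Unshelve. all: by end_near. Qed.

Lemma derivative_on_FTC T d d' : derivative_on T d d' -> {within `[0, T], continuous d'} ->
  forall t, 0 <= t <= T -> d t = d 0 + \int[mu]_(s in `[0, t]) d' s.
Proof.
move=> H cd' t /andP[]; rewrite le_eqVlt => /predU1P[<- _|t0 tT].
  by rewrite set_itv1 Rintegral_set1 addr0.
have sub : `[0, t] `<=` `[0, T] by apply: subset_itvl; rewrite bnd_simp.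
have cd := derivative_on_continuous H.
rewrite /Rintegral (@continuous_FTC2 _ d' d)//.
- by rewrite -EFinB /= addrC subrK.
- exact: continuous_subspaceW cd'.
- have /continuous_within_itvP : {within `[0, t], continuous d} by exact: continuous_subspaceW cd.
  move=> /(_ t0) [_ ? ?]; split => // s; rewrite in_itv/= => /andP[s0 st].
  by have [] := derivative_on_is_derive H (introT andP (conj s0 (lt_le_trans st tT))).
- move=> s; rewrite in_itv/= => /andP[s0 st].
  have [_ <-] := derivative_on_is_derive H (introT andP (conj s0 (lt_le_trans st tT))).
  by rewrite derive1E.
Qed.
End FTC.

(** * From the Caputo problem to the Volterra system *)

Section Taylor.
Context {R : realType}.
Local Notation mu := (@lebesgue_measure R).
Implicit Types (T t : R).

Lemma real_frac_int1 (g : R -> R) t : real_frac_int 1 g t = \int[mu]_(s in `[0, t]) g s.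
Proof.
rewrite /real_frac_int gamma_fun1 invr1 mul1r; apply: eq_Rintegral => s _.
by rewrite subrr powRr0 mul1r.
Qed.

Lemma bmeas_exprn T i : bmeas T (fun s : R => s ^+ i).
Proof.
apply: eq_bmeas (bmeas_powR T (ler0n R i)) => s /andP[s0 _].
by rewrite powR_mulrn.
Qed.

Lemma real_frac_int1_exprn i t : 0 <= t ->
  real_frac_int 1 (fun s : R => s ^+ i) t = t ^+ i.+1 / i.+1%:R.
Proof.
move=> t0; rewrite real_frac_int1; move: t0; rewrite le_eqVlt => /predU1P[<-|t0].
  by rewrite set_itv1 Rintegral_set1 expr0n mul0r.
pose F (x : R) : R := i.+1%:R^-1 * x ^+ i.+1.
have dF (x : R) : is_derive x 1 F (x ^+ i).
  have H : is_derive x (1 : R) (fun y : R => y ^+ i.+1) ((i.+1%:R * x ^+ i) *: 1).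
    have -> : (fun y : R => y ^+ i.+1) = (id : R -> R) ^+ i.+1 by rewrite exprfctE.
    exact: (is_deriveX i.+1 (is_derive_id x 1)).
  apply: is_derive_eq.
  by rewrite /GRing.scale/= mulr1 mulrA mulVf ?mul1r// pnatr_eq0.
have cF : continuous F.
  by move=> x; apply: differentiable_continuous; apply/derivable1_diffP; have [] := dF x.
rewrite /Rintegral (@continuous_FTC2 _ _ F)//.
- by rewrite -EFinB /F/= expr0n mulr0 subr0 mulrC.
- by apply: continuous_subspaceT => x; exact: exprn_continuous.
- have /continuous_within_itvP : {within `[0, t], continuous F} by exact: continuous_subspaceT.
  by move=> /(_ t0) [_ ? ?]; split => // s _; have [] := dF s.
- by move=> s _; have [_ <-] := dF s; rewrite derive1E.
Qed.

Lemma bmeas_poly T n (c : nat -> R) : bmeas T (fun s : R => \sum_(i < n) c i * s ^+ i).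
Proof.
elim: n => [|n IH]; first by under eq_fun do rewrite big_ord0; exact: bmeas_cst.
under eq_fun do rewrite big_ord_recr/=; apply: bmeasD => //.
by apply: bmeasM; [exact: bmeas_cst|exact: bmeas_exprn].
Qed.

Lemma real_frac_int1_poly n (c : nat -> R) t : 0 <= t ->
  real_frac_int 1 (fun s : R => \sum_(i < n) c i * s ^+ i) t =
  \sum_(i < n) c i * (t ^+ i.+1 / i.+1%:R).
Proof.
move=> t0; elim: n => [|n IH].
  rewrite big_ord0 -[RHS](mul0r (real_frac_int 1 (fun=> 0) t)).
  rewrite -real_frac_intZ//; last exact: bmeas_cst.
  by apply: eq_real_frac_int => s _; rewrite big_ord0 mul0r.
rewrite big_ord_recr/= -IH -real_frac_int1_exprn// -real_frac_intZ//; last exact: bmeas_exprn.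
rewrite -real_frac_intD//; last 2 first.
- exact: bmeas_poly.
- by apply: bmeasM; [exact: bmeas_cst|exact: bmeas_exprn].
by apply: eq_real_frac_int => s _; rewrite big_ord_recr.
Qed.

(** Taylor's formula with integral remainder, by descending induction on the
    order of the derivative: d_k - d_k(0) is I^1 d_(k+1), the polynomial part
    is integrated explicitly, and I^1 I^j = I^(j+1) absorbs the remainder.  The
    last derivative is merely integrable. *)
Lemma taylor_real_frac_int T (m : nat) (d : nat -> R -> R) : 0 <= T -> (0 < m)%N ->
  (forall k, (k.+1 < m)%N -> derivative_on T (d k) (d k.+1)) ->
  mu.-integrable `[0, T] (EFin \o d m) ->
  (forall t, 0 <= t <= T -> d m.-1 t = d m.-1 0 + \int[mu]_(s in `[0, t]) d m s) ->
  forall t, 0 <= t <= T ->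
  d 0%N t = \sum_(k < m) d k 0 / k`!%:R * t ^+ k + real_frac_int m%:R (d m) t.
Proof.
move=> T0 m0 dd im pm.
have cd k : (k < m)%N -> {within `[0, T], continuous (d k)}.
  rewrite leq_eqVlt => /predU1P[km|km]; last exact: derivative_on_continuous (dd k km).
  have cI := parameterized_integral_continuous T0 im.
  have E : {in `[0, T]%classic, (fun t => d k 0 + parameterized_integral mu 0 t (d m)) =1 d k}.
    by move=> t; rewrite inE/= in_itv/= => tT; have := pm t tT; rewrite -km/= => ->.
  apply: (subspace_eq_continuous E) => t.
  by apply: cvgD; [exact: cvg_cst|exact: cI].
have key j : (j < m)%N -> forall t, 0 <= t <= T ->
    d (m.-1 - j)%N t = \sum_(i < j.+1) d (m.-1 - j + i)%N 0 / i`!%:R * t ^+ i +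
      real_frac_int j.+1%:R (d m) t.
  elim: j => [_ t tT|j IH jm t tT].
    rewrite subn0 big_ord_recl big_ord0/= addn0 expr0 mulr1 divr1 addr0 real_frac_int1.
    exact: pm.
  have jm' : (j < m)%N by exact: ltnW.
  set k := (m.-1 - j.+1)%N.
  have kE : k.+1 = (m.-1 - j)%N by rewrite /k subnS prednK// subn_gt0 -ltnS prednK.
  have km : (k.+1 < m)%N.
    by rewrite kE -[ltnRHS](prednK m0) ltnS leq_subr.
  have dk := derivative_on_FTC (dd k km) (cd _ km) tT.
  rewrite dk -real_frac_int1.
  pose P s := \sum_(i < j.+1) d (k.+1 + i)%N 0 / i`!%:R * s ^+ i.
  pose h s := d k.+1 s - P s.
  have [t0 tT'] := andP tT.
  have bd : bmeas t (d k.+1) by apply: (bmeasS tT'); exact: bmeas_continuous (cd _ km).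
  have bP : bmeas t P by exact: (bmeas_poly t j.+1 (fun i => d (k.+1 + i)%N 0 / i`!%:R)).
  have bh : bmeas t h by exact: bmeasD bd (bmeasN bP).
  rewrite (_ : real_frac_int 1 (d k.+1) t = real_frac_int 1 P t + real_frac_int 1 h t); last first.
    by rewrite -real_frac_intD//; apply: eq_real_frac_int => s _; rewrite addrC subrK.
  rewrite (@real_frac_int_semigroup _ 1 j.+1%:R T (d m) h)//; last 2 first.
  - by rewrite lerDl.
  - move=> s /andP[s0 sT]; rewrite /h kE IH//; last by rewrite ltW.
    by rewrite /P kE addrC addKr.
  rewrite [in RHS]mulrS addrA; congr (_ + _).
  rewrite big_ord_recl/= addn0 divr1 expr0 mulr1; congr (_ + _).
  rewrite (@real_frac_int1_poly j.+1 (fun i => d (k.+1 + i)%N 0 / i`!%:R) t t0).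
  apply: eq_bigr => i _.
  rewrite /bump/= add1n addnS addSn factS natrM.
  rewrite invfM exprS; field.
  by rewrite nat1r !pnatr_eq0 -lt0n fact_gt0.
move=> t tT; have := key m.-1; rewrite ltn_predL subnn prednK// => /(_ m0 t tT).
by under eq_bigr do rewrite add0n.
Qed.

Lemma natr_realC (n : nat) : (n%:R : R[i]) = (n%:R : R)%:C.
Proof. by rewrite rmorph_nat. Qed.

Lemma taylor_frac_int T (m : nat) (g : R -> R[i]) (D : nat -> R -> R[i]) :
  0 <= T -> (0 < m)%N -> derivatives_on T m g D ->
  forall t, 0 <= t <= T ->
  g t = \sum_(k < m) D k 0 / k`!%:R * (t ^+ k)%:C + frac_int m%:R (D m) t.
Proof.
move=> T0 m0 [Dg dD [[iR iI] pD]] t tT.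
rewrite -Dg ?in_itv//= frac_intE.
have pp s : 0 <= s <= T -> D m.-1 s = D m.-1 0 + cintegral `[0, s] (D m).
  by move=> sT; apply: pD; rewrite in_itv.
have TR := @taylor_real_frac_int T m (fun k s => complex.Re (D k s)) T0 m0 _ iR _ t tT.
have TI := @taylor_real_frac_int T m (fun k s => complex.Im (D k s)) T0 m0 _ iI _ t tT.
have SR : complex.Re (\sum_(k < m) D k 0 / k`!%:R * (t ^+ k)%:C) =
    \sum_(k < m) complex.Re (D k 0) / k`!%:R * t ^+ k.
  rewrite raddf_sum/=; apply: eq_bigr => k _.
  rewrite natr_realC -fmorphV; case: (D k 0) => x y /=.
  by rewrite !mulr0 !subr0.
have SI : complex.Im (\sum_(k < m) D k 0 / k`!%:R * (t ^+ k)%:C) =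
    \sum_(k < m) complex.Im (D k 0) / k`!%:R * t ^+ k.
  rewrite raddf_sum/=; apply: eq_bigr => k _.
  rewrite natr_realC -fmorphV; case: (D k 0) => x y /=.
  by rewrite !mulr0 !add0r.
apply/eqP; rewrite eq_complex raddfD/= SR.
rewrite (raddfD (@complex.Im R))/= SI.
rewrite TR ?TI ?eqxx//.
- by move=> k km; have [] := has_derivative_ReIm (dD k km).
- by move=> s sT; rewrite (pp s sT) raddfD.
- by move=> k km; have [] := has_derivative_ReIm (dD k km).
- by move=> s sT; rewrite (pp s sT) raddfD.
Qed.

(** Apply I^theta to the equation: I^theta I^(m - theta) = I^m for
    m = ceil theta, and I^m D_m is the Taylor remainder of g. *)
Lemma caputo_volterra T (theta : R) (v0 : nat -> R[i]) (g G : R -> R[i])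
    (D : nat -> R -> R[i]) :
  0 <= T -> 0 < theta < (nceil theta)%:R ->
  derivatives_on T (nceil theta) g D ->
  (forall k, (k < nceil theta)%N -> D k 0 = v0 k) ->
  (forall t, 0 < t <= T -> caputo theta D t = G t) ->
  forall t, 0 <= t <= T -> g t = psi theta v0 t + frac_int theta G t.
Proof.
move=> T0 /andP[th0 thm] dg D0 cap t tT.
have m0 : (0 < nceil theta)%N by rewrite -(ltr0n R) (lt_trans th0).
rewrite (taylor_frac_int T0 m0 dg tT) /psi; congr (_ + _).
  by apply: eq_bigr => k _; rewrite D0.
have [_ _ [[iR iI] _]] := dg.
have mE : (nceil theta)%:R = theta + ((nceil theta)%:R - theta) :> R by rewrite addrC subrK.
rewrite !frac_intE; congr (_ +i* _); rewrite [in LHS]mE; apply/esym.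
  apply: (real_frac_int_semigroup th0 _ _ iR _ tT); rewrite ?subr_gt0//.
    by rewrite -mE ler1n.
  by move=> s sT; rewrite -cap// /caputo frac_intE.
apply: (real_frac_int_semigroup th0 _ _ iI _ tT); rewrite ?subr_gt0//.
  by rewrite -mE ler1n.
by move=> s sT; rewrite -cap// /caputo frac_intE.
Qed.

(** A fraction in lowest terms with denominator at least 2 is not an integer,
    so the order ceil theta - theta of the integral in the Caputo derivative is
    positive. *)
Lemma nceil_ratio_gt (p q : nat) : (0 < p)%N -> (1 < q)%N -> coprime p q ->
  p%:R / q%:R < (nceil (p%:R / q%:R : R))%:R :> R.
Proof.
move=> p0 q1 pq; have q0 : 0 < q%:R :> R by rewrite ltr0n ltnW.
have x0 : 0 < p%:R / q%:R :> R by rewrite divr_gt0// ltr0n.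
rewrite /nceil lt_neqAle; apply/andP; split; last first.
  by rewrite natr_absz ger0_norm ?ceil_ge// ceil_ge0 (lt_trans _ x0)// ltrN10.
apply/negP => /eqP; move: (absz _) => k H.
have : (p = k * q)%N.
  by apply/eqP; rewrite -(eqr_nat R) natrM -H divfK// gt_eqF.
move=> pkq; move: pq; rewrite pkq /coprime gcdnC gcdnMl => /eqP q1'.
by rewrite q1' in q1.
Qed.

End Taylor.

(** * Majorants of power series and of the coefficient recursion *)

Section PowerSeries.
Context {R : realType}.
Implicit Types (x y : R).

Lemma geometric_sum_le2 y n : 0 <= y <= 2^-1 -> \sum_(i < n) y ^+ i <= 2.
Proof.
move=> /andP[y0 y1]; elim: n => [|n IH]; first by rewrite big_ord0.
rewrite big_ord_recl expr0 (_ : \sum_(i < n) _ = y * \sum_(i < n) y ^+ i); last first.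
  by rewrite big_distrr; apply: eq_bigr => i _ /=; rewrite -exprS.
have : y * \sum_(i < n) y ^+ i <= 2^-1 * 2.
  by rewrite ler_pM// sumr_ge0// => i _; rewrite exprn_ge0.
by rewrite mulVf ?pnatr_eq0//; lra.
Qed.

(** Convergence at z0 = rho/2 bounds the terms a_k z0^k, hence the a_k by a
    geometric sequence; the tail at x is then dominated by a geometric series
    of ratio L x <= 1/2. *)
Lemma analytic_majorant (g : R[i] -> R[i]) : analytic_at g 0 ->
  exists (a : nat -> R[i]) (A L : R), [/\ 0 <= A, 1 <= L,
    forall k, l1norm (a k) <= A * L ^+ k &
    forall x, 0 <= x -> L * x <= 2^-1 -> forall K,
      l1norm (g x%:C - \sum_(k < K) a k * (x ^+ k)%:C) <= A * (L * x) ^+ K].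
Proof.
move=> [a [rho [rho0 H]]].
have {}H x : 0 <= x < rho -> forall e : R, 0 < e ->
    \forall N \near \oo, l1norm (g x%:C - \sum_(k < N) a k * (x ^+ k)%:C) < e.
  move=> /andP[x0 xr] e e0.
  have := H x%:C; rewrite subr0 normc_def/= expr0n addr0 sqrtr_sqr ltcR ger0_norm//.
  move=> /(_ xr) /cvg_l1normP /(_ e e0); apply: filterS => N.
  by under eq_bigr do rewrite -rmorphXn.
pose z0 := rho / 2.
have z00 : 0 < z0 by rewrite divr_gt0.
have z0r : z0 < rho by rewrite /z0 ltr_pdivrMr// ltr_pMr// ltr1n.
have [N0 _ HN] := H z0 (introT andP (conj (ltW z00) z0r)) 1 ltr01.
pose t k := l1norm (a k * (z0 ^+ k)%:C).
pose A := 2 + \sum_(k < N0) t k.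
have t0 k : 0 <= t k by exact: l1norm_ge0.
have A2 : 2 <= A by rewrite lerDl sumr_ge0.
have tA k : t k <= A.
  have [kN|Nk] := ltnP k N0.
    rewrite /A (bigD1 (Ordinal kN))//= addrCA lerDl addr_ge0// sumr_ge0//.
  rewrite (le_trans _ A2)//.
  have h1 := HN k Nk; have h2 := HN k.+1 (leqW Nk).
  rewrite /t; set S := \sum_(i < k) a i * (z0 ^+ i)%:C in h1.
  move: h2; rewrite /= big_ord_recr/= -/S => h2.
  have -> : a k * (z0 ^+ k)%:C = (g z0%:C - S) - (g z0%:C - (S + a k * (z0 ^+ k)%:C)) by ring.
  by apply: (le_trans (l1normB _ _)); rewrite -[2]/(1 + 1) lerD// ltW.
have aA k : l1norm (a k) <= A * z0^-1 ^+ k.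
  have := tA k; rewrite /t mulrC l1norm_realM ger0_norm ?exprn_ge0 ?(ltW z00)// => h.
  by rewrite exprVn ler_pdivlMr ?exprn_gt0// mulrC.
pose L := z0^-1 + 1.
have L1 : 1 <= L by rewrite lerDr invr_ge0 ltW.
have L0 : 0 < L by rewrite (lt_le_trans ltr01).
have A0 : 0 <= A by rewrite (le_trans _ A2).
have aL k : l1norm (a k) <= A * L ^+ k.
  apply: (le_trans (aA k)); rewrite ler_wpM2l// lerXn2r ?nnegrE ?invr_ge0 ?(ltW z00) ?(ltW L0)//.
  by rewrite lerDl.
exists a, (2 * A), L; split => //.
- by rewrite mulr_ge0.
- by move=> k; rewrite -mulrA mulr_natl mulr2n (le_trans (aL k))// lerDl mulr_ge0// exprn_ge0// ltW.
move=> x x0 Lx K.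
have xr : 0 <= x < rho.
  rewrite x0 (le_lt_trans _ z0r)//.
  have : L * x <= 1 by rewrite (le_trans Lx)// invf_le1// ler1n.
  rewrite mulrDl mul1r => h.
  have : z0^-1 * x <= 1 by rewrite (le_trans _ h)// lerDl.
  by rewrite mulrC ler_pdivrMr// mul1r.
apply/ler_addgt0Pr => e e0.
have [N1 _ HN1] := H x xr e e0.
have := HN1 (K + N1)%N (leq_addl _ _) => /=.
rewrite big_split_ord/=; set S := \sum_(i < K) _; set Q := \sum_(i < N1) _ => h.
have -> : g x%:C - S = (g x%:C - (S + Q)) + Q by ring.
rewrite (le_trans (l1normD _ _))// addrC lerD ?(ltW h)//.
apply: (le_trans (l1norm_sum _ _ _)).
apply: (@le_trans _ _ (\sum_(i < N1) A * (L * x) ^+ K * (L * x) ^+ i)).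
  apply: ler_sum => i _; rewrite mulrC l1norm_realM ger0_norm ?exprn_ge0//.
  rewrite -mulrA -exprD exprMn mulrA mulrC ler_wpM2r ?exprn_ge0//.
rewrite -big_distrr/= [leRHS]mulrC mulrA [leRHS]mulrC.
rewrite -mulrA ler_wpM2l//.
rewrite ler_wpM2l ?exprn_ge0 ?mulr_ge0 ?(ltW L0)//.
by apply: geometric_sum_le2; rewrite Lx mulr_ge0// ltW.
Qed.

End PowerSeries.

Section Recursion.
Context {R : realType} (n : nat).
Implicit Types (W X Y : 'I_n -> nat -> R[i]).

(** Iterating Phi from 0, the entries of index below k no longer change after
    k steps. *)
Lemma causal_fixpoint (Phi : ('I_n -> nat -> R[i]) -> 'I_n -> nat -> R[i]) :
  (forall X Y j k, (forall r i, (i < k)%N -> X r i = Y r i) -> Phi X j k = Phi Y j k) ->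
  exists W, forall j k, W j k = Phi W j k.
Proof.
move=> causal.
pose X i := iter i Phi (fun _ _ => 0).
have stable i k : forall p r, (k < i)%N -> (k < p)%N -> X i r k = X p r k.
  elim/ltn_ind: k i => k IH [|i] [|p] r //; rewrite !ltnS => ki kp.
  by rewrite /X/=; apply: causal => r' k' k'k; apply: IH => //; apply: (leq_trans k'k).
exists (fun r k => X k.+1 r k) => j k.
rewrite [LHS]/=; apply: causal => r i ik.
by apply: stable.
Qed.

(** The coefficient of z^i in sum_r p_(j,r) v_r + p_(j,n+1), when a j r, b j
    and W r are the coefficient sequences of p_(j,r), p_(j,n+1) and v_r. *)
Definition cauchy_coef (a : 'I_n -> 'I_n -> nat -> R[i]) (b : 'I_n -> nat -> R[i])
    W (j : 'I_n) (i : nat) : R[i] :=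
  \sum_(r < n) \sum_(k < i.+1) a j r (i - k)%N * W r k + b j i.

Lemma recursion_exists (m : 'I_n -> nat) (c : 'I_n -> nat -> R)
    (a : 'I_n -> 'I_n -> nat -> R[i]) (b psc : 'I_n -> nat -> R[i]) :
  (forall j, (0 < m j)%N) ->
  exists W, forall j k, W j k = psc j k +
    (if (m j <= k)%N then (c j (k - m j)%N)%:C * cauchy_coef a b W j (k - m j) else 0).
Proof.
move=> m0; apply: (causal_fixpoint (Phi := fun W j k => psc j k +
    (if (m j <= k)%N then (c j (k - m j)%N)%:C * cauchy_coef a b W j (k - m j) else 0))).
move=> X Y j k XY; congr (_ + _); case: ifP => // mk; congr (_ * (_ + _)).
apply: eq_bigr => r _; apply: eq_bigr => i _; rewrite XY//.
by rewrite (leq_trans (ltn_ord i))// ltn_subrL m0 (leq_trans (m0 j)).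
Qed.

(** Strong induction.  The coefficient of index k depends on those of index at
    most k - 1, so its new part carries only Lam^(k-1) and the missing factor
    Lam absorbs the constants; as L / Lam <= 1/2, a Cauchy product costs no
    more than a factor 2. *)
Lemma recursion_bound (m : 'I_n -> nat) (c : 'I_n -> nat -> R)
    (a : 'I_n -> 'I_n -> nat -> R[i]) (b psc W : 'I_n -> nat -> R[i])
    (kappa A L M Lam : R) :
  (forall j, (0 < m j)%N) ->
  (forall j k, 0 <= c j k <= kappa) -> 0 <= A -> 1 <= L -> 1 <= M ->
  (forall j r k, l1norm (a j r k) <= A * L ^+ k) ->
  (forall j k, l1norm (b j k) <= A * L ^+ k) ->
  (forall j k, l1norm (psc j k) <= M / 2) ->
  2 * L <= Lam -> 2 * (kappa * A * (2 * n%:R + 1)) <= Lam ->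
  (forall j k, W j k = psc j k +
    (if (m j <= k)%N then (c j (k - m j)%N)%:C * cauchy_coef a b W j (k - m j) else 0)) ->
  forall j k, l1norm (W j k) <= M * Lam ^+ k.
Proof.
move=> m0 ck A0 L1 M1 aL bL psM LL Lk WE j k.
have L0 : 0 < L by rewrite (lt_le_trans ltr01).
have M0 : 0 < M by rewrite (lt_le_trans ltr01).
have Lam1 : 1 <= Lam by lra.
have Lam0 : 0 < Lam by lra.
elim/ltn_ind: k j => k IH j; rewrite WE.
have LX p : 1 <= Lam ^+ p by rewrite exprn_ege1.
have ps : l1norm (psc j k) <= M * Lam ^+ k / 2.
  by rewrite (le_trans (psM j k))// ler_wpM2r// ler_peMr// ltW.
case: ifP => [mk|_]; last
  by rewrite addr0 (le_trans ps)// ler_pdivrMr// ler_pMr ?mulr_gt0 ?exprn_gt0 ?ler1n.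
apply: (le_trans (l1normD _ _)); rewrite [leRHS](splitr) lerD//.
set i := (k - m j)%N.
have ik : (i < k)%N by rewrite ltn_subrL m0 (leq_trans (m0 j)).
have [c0 ckap] := andP (ck j i).
have K0 : 0 <= kappa by rewrite (le_trans c0).
rewrite l1norm_realM ger0_norm//.
have HH : l1norm (cauchy_coef a b W j i) <= A * M * Lam ^+ i * (2 * n%:R + 1).
  rewrite mulrDr mulr1; apply: (le_trans (l1normD _ _)); apply: lerD; last first.
    apply: (le_trans (bL j i)); rewrite -mulrA ler_wpM2l//.
    rewrite (@le_trans _ _ (Lam ^+ i))//.
      by rewrite lerXn2r ?nnegrE ?(ltW L0) ?(ltW Lam0)//; lra.
    by rewrite ler_peMl// exprn_ge0// ltW.
  apply: (le_trans (l1norm_sum _ _ _)).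
  rewrite (_ : A * M * Lam ^+ i * (2 * n%:R) = \sum_(r < n) A * M * Lam ^+ i * 2); last first.
    by rewrite sumr_const card_ord -[RHS]mulr_natr; ring.
  apply: ler_sum => r _; apply: (le_trans (l1norm_sum _ _ _)).
  apply: (@le_trans _ _ (\sum_(v < i.+1) A * M * Lam ^+ i * 2^-1 ^+ (i - v))).
    apply: ler_sum => v _; apply: (le_trans (l1normM _ _)).
    have vi : (v <= i)%N by rewrite -ltnS.
    apply: (@le_trans _ _ ((A * L ^+ (i - v)) * (M * Lam ^+ v))).
      by rewrite ler_pM ?l1norm_ge0// IH// (leq_ltn_trans vi).
    have -> : Lam ^+ i = Lam ^+ (i - v) * Lam ^+ v by rewrite -exprD subnK.
    rewrite (_ : A * L ^+ (i - v) * (M * Lam ^+ v) = A * M * Lam ^+ v * L ^+ (i - v)); last by ring.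
    rewrite (_ : A * M * (Lam ^+ (i - v) * Lam ^+ v) * 2^-1 ^+ (i - v) =
      A * M * Lam ^+ v * (Lam * 2^-1) ^+ (i - v)); last by rewrite exprMn; ring.
    rewrite ler_wpM2l ?mulr_ge0 ?(ltW M0) ?exprn_ge0 ?(ltW Lam0)//.
    by rewrite lerXn2r ?nnegrE ?(ltW L0) ?mulr_ge0 ?(ltW Lam0)// ler_pdivlMr// mulrC.
  rewrite -big_distrr/= ler_wpM2l ?mulr_ge0 ?(ltW M0) ?exprn_ge0 ?(ltW Lam0)//.
  rewrite (reindex_inj rev_ord_inj)/=.
  rewrite (eq_bigr (fun v : 'I_i.+1 => 2^-1 ^+ v)); last first.
    by move=> v _; rewrite subSS subKn// -ltnS.
  by apply: geometric_sum_le2; rewrite lexx invr_ge0 ler0n.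
apply: (@le_trans _ _ (kappa * (A * M * Lam ^+ i * (2 * n%:R + 1)))).
  by rewrite ler_pM ?l1norm_ge0.
rewrite (_ : kappa * _ = M * Lam ^+ i * (kappa * A * (2 * n%:R + 1))); last by ring.
rewrite -[leRHS]mulrA.
apply: (@le_trans _ _ (M * Lam ^+ i * (Lam / 2))).
  rewrite ler_wpM2l ?mulr_ge0 ?(ltW M0) ?exprn_ge0 ?(ltW Lam0)//.
  by rewrite ler_pdivlMr// mulrC.
rewrite -mulrA ler_wpM2l ?(ltW M0)// mulrA ler_wpM2r// -exprSr.
by rewrite ler_weXn2l.
Qed.

End Recursion.

(** * Partial sums and their residual *)

Section Truncation.

(** The part of p times the sum that lies in degrees below K cancels, and what
    is left of the term of degree v is its product with the tail of p from
    degree K - v on. *)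
Lemma truncated_cauchy_product (S : comPzRingType) (a w : nat -> S) (p z : S) (K N : nat) :
  (K <= N)%N ->
  p * (\sum_(v < N) w v * z ^+ v) -
    \sum_(i < K) (\sum_(v < i.+1) a (i - v)%N * w v) * z ^+ i =
  \sum_(v < N) w v * z ^+ v * (p - \sum_(k < K - v) a k * z ^+ k).
Proof.
move=> KN.
have E : \sum_(i < K) (\sum_(v < i.+1) a (i - v)%N * w v) * z ^+ i =
    \sum_(v < N) w v * z ^+ v * \sum_(k < K - v) a k * z ^+ k.
  elim: K KN => [|K IH] KN.
    by rewrite big_ord0 big1// => v _; rewrite sub0n big_ord0 mulr0.
  rewrite big_ord_recr/= IH ?(ltnW KN)//.
  rewrite (big_ord_widen N (fun v => a (K - v)%N * w v) KN) big_distrl/=.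
  rewrite [X in _ + X]big_mkcond -big_split/=; apply: eq_bigr => v _.
  rewrite ltnS; case: leqP => vK.
    rewrite subSn// big_ord_recr/= mulrDr; congr (_ + _).
    by rewrite -[in LHS](subnKC vK) exprD addKn; ring.
  have -> : (K.+1 - v = 0)%N by apply/eqP; rewrite subn_eq0.
  have -> : (K - v = 0)%N by apply/eqP; rewrite subn_eq0 ltnW.
  by rewrite addr0.
rewrite E big_distrr/= -sumrB; apply: eq_bigr => v _; ring.
Qed.

Context {R : realType}.

Lemma truncated_product_bound (a w : nat -> R[i]) (p : R[i]) (x A M Lam : R) (K N : nat) :
  (K <= N)%N -> 0 <= A -> 0 <= M -> 0 <= Lam -> 0 <= x -> Lam * x <= 1 ->
  (forall k, l1norm (w k) <= M * Lam ^+ k) ->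
  (forall k, l1norm (p - \sum_(i < k) a i * (x ^+ i)%:C) <= A * (Lam * x) ^+ k) ->
  l1norm (p * (\sum_(v < N) w v * (x ^+ v)%:C) -
     \sum_(i < K) (\sum_(v < i.+1) a (i - v)%N * w v) * (x ^+ i)%:C) <=
  N%:R * (M * A * (Lam * x) ^+ K).
Proof.
move=> KN A0 M0 Lam0 x0 y1 wM pA.
have y0 : 0 <= Lam * x by rewrite mulr_ge0.
have := truncated_cauchy_product a w p x%:C KN.
under eq_bigr do rewrite -rmorphXn/=.
under [X in _ - X]eq_bigr do rewrite -rmorphXn/=.
move=> ->; apply: (le_trans (l1norm_sum _ _ _)).
rewrite (_ : N%:R * _ = \sum_(v < N) (M * A * (Lam * x) ^+ K)); last first.
  by rewrite sumr_const card_ord mulr_natl.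
apply: ler_sum => v _.
rewrite -rmorphXn/=; under eq_bigr do rewrite -rmorphXn/=.
apply: (le_trans (l1normM _ _)).
apply: (@le_trans _ _ ((M * (Lam * x) ^+ v) * (A * (Lam * x) ^+ (K - v)))).
  apply: ler_pM; rewrite ?l1norm_ge0//.
  rewrite mulrC l1norm_realM ger0_norm ?exprn_ge0// exprMn mulrA mulrC.
  by rewrite ler_wpM2r ?exprn_ge0.
  exact: pA.
rewrite mulrACA -exprD ler_wpM2l ?mulr_ge0//.
by apply: ler_wiXn2l => //; rewrite -leq_subLR.
Qed.

(** After k steps the bound is |B| / 2^k + 2 e. *)
Lemma halving_iteration (P : R -> Prop) (B e : R) : 0 <= e ->
  (forall b b', b <= b' -> P b -> P b') -> P B -> (forall b, P b -> P (b / 2 + e)) ->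
  forall eta, 0 < eta -> P (2 * e + eta).
Proof.
move=> e0 mono PB step eta eta0.
have it k : P (`|B| / 2 ^+ k + 2 * e).
  elim: k => [|k IH].
    apply: mono PB; rewrite expr0 divr1 (le_trans (ler_norm B))// lerDl.
    by rewrite mulr_ge0.
  apply: mono (step _ IH); rewrite exprSr invfM; lra.
apply: mono (it (Num.truncn (`|B| / eta)).+1); rewrite addrC lerD2l.
rewrite ler_pdivrMr ?exprn_gt0// mulrC -ler_pdivrMr//.
apply: (le_trans (ltW (truncnS_gt _))).
by rewrite -natrX ler_nat ltnW// ltn_expl.
Qed.

Lemma powR_root (t : R) (q k : nat) : (0 < q)%N -> 0 <= t ->
  t `^ (k%:R / q%:R) = (t `^ q%:R^-1) ^+ k.
Proof. by move=> q0 t0; rewrite mulrC powRrM powR_mulrn// powR_ge0. Qed.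

(** The coefficient of z^k in psi, where z^q = t. *)
Definition psi_coef (q : nat) (theta : R) (v0 : nat -> R[i]) (k : nat) : R[i] :=
  \sum_(i < nceil theta) if k == (i * q)%N then v0 i / i`!%:R else 0.

Lemma psi_series (q : nat) (theta : R) (v0 : nat -> R[i]) (t : R) (N : nat) :
  (0 < q)%N -> 0 <= t -> (nceil theta * q <= N)%N ->
  psi theta v0 t = \sum_(k < N) psi_coef q theta v0 k * ((t `^ q%:R^-1) ^+ k)%:C.
Proof.
move=> q0 t0 hN.
under eq_bigr do rewrite /psi_coef big_distrl/=.
rewrite exchange_big/= /psi; apply: eq_bigr => i _.
have iN : (i * q < N)%N by apply: leq_trans hN; rewrite ltn_mul2r q0/=.
rewrite (bigD1 (Ordinal iN))//= eqxx big1 ?addr0; last first.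
  move=> k ki; case: eqP => [ke|_]; last by rewrite mul0r.
  by exfalso; move/eqP: ki; apply; apply: val_inj.
congr (_ * _%:C); rewrite -powR_root// natrM mulfK ?powR_mulrn//.
by rewrite pnatr_eq0 -lt0n.
Qed.

Lemma psi_coef_bound q theta v0 k :
  l1norm (psi_coef q theta v0 k) <= \sum_(i < nceil theta) l1norm (v0 i / i`!%:R).
Proof.
apply: (le_trans (l1norm_sum _ _ _)); apply: ler_sum => i _.
by case: ifP => // _; rewrite l1norm0 l1norm_ge0.
Qed.

Lemma ler_term_sum (I : finType) (F : I -> R) i : (forall j, 0 <= F j) -> F i <= \sum_j F j.
Proof. by move=> F0; rewrite (bigD1 i)//= lerDl sumr_ge0. Qed.

(** Sums over the finite index set serve as common constants. *)
Lemma uniform_majorant (I : finType) (g : I -> R[i] -> R[i]) :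
  (forall i, analytic_at (g i) 0) ->
  exists (a : I -> nat -> R[i]) (A L : R), [/\ 0 <= A, 1 <= L,
    forall i k, l1norm (a i k) <= A * L ^+ k &
    forall i x, 0 <= x -> L * x <= 2^-1 -> forall K,
      l1norm (g i x%:C - \sum_(k < K) a i k * (x ^+ k)%:C) <= A * (L * x) ^+ K].
Proof.
move=> /(_ _) /analytic_majorant H.
have {H} H i : exists y : (nat -> R[i]) * R * R, [/\ 0 <= y.1.2, 1 <= y.2,
    forall k, l1norm (y.1.1 k) <= y.1.2 * y.2 ^+ k &
    forall x, 0 <= x -> y.2 * x <= 2^-1 -> forall K,
      l1norm (g i x%:C - \sum_(k < K) y.1.1 k * (x ^+ k)%:C) <= y.1.2 * (y.2 * x) ^+ K].
  by have [a [A [L HH]]] := H i; exists (a, A, L).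
have [F HF] := choice H.
have A0 i : 0 <= (F i).1.2 by have [] := HF i.
have L1 i : 1 <= (F i).2 by have [] := HF i.
have L0 i : 0 <= (F i).2 by rewrite (le_trans ler01).
have AL i : (F i).1.2 <= \sum_j (F j).1.2 by exact: (@ler_term_sum _ (fun j => (F j).1.2)).
have LL i : (F i).2 <= 1 + \sum_j (F j).2.
  by rewrite (le_trans (@ler_term_sum _ (fun j => (F j).2) i L0))// lerDr.
exists (fun i => (F i).1.1), (\sum_j (F j).1.2), (1 + \sum_j (F j).2); split.
- exact: sumr_ge0.
- by rewrite lerDl sumr_ge0.
- move=> i k; have [_ _ /(_ k) h _] := HF i; apply: (le_trans h).
  by rewrite ler_pM ?exprn_ge0// lerXn2r ?nnegrE// (le_trans (L0 i)).
- move=> i x x0 Lx K; have [_ _ _ h] := HF i.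
  have Lx' : (F i).2 * x <= (1 + \sum_j (F j).2) * x by rewrite ler_wpM2r.
  apply: (le_trans (h x x0 (le_trans Lx' Lx) K)).
  rewrite ler_pM ?exprn_ge0 ?mulr_ge0// lerXn2r ?nnegrE ?mulr_ge0//.
  by rewrite (le_trans (L0 i)).
Qed.

(** The P_r and Q are values of power series at x, and the V_r are within B of
    truncated series.  The right-hand side sum_r P_r V_r + Q then differs from
    its own series truncated at degree K by the propagated error, at most A B
    for each r, by the n truncation errors of Cauchy products, and by the tail
    of Q. *)
Lemma rhs_residual_bound (n : nat) (P V : 'I_n -> R[i]) (Q : R[i]) (a : 'I_n -> nat -> R[i])
    (b : nat -> R[i]) (w : 'I_n -> nat -> R[i]) (x A M Lam B : R) (K N : nat) :
  (K <= N)%N -> (0 < N)%N -> 0 <= A -> 1 <= M -> 0 <= Lam -> 0 <= x -> Lam * x <= 1 ->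
  (forall r k, l1norm (w r k) <= M * Lam ^+ k) ->
  (forall r k, l1norm (P r - \sum_(i < k) a r i * (x ^+ i)%:C) <= A * (Lam * x) ^+ k) ->
  (forall k, l1norm (Q - \sum_(i < k) b i * (x ^+ i)%:C) <= A * (Lam * x) ^+ k) ->
  (forall r, l1norm (V r - \sum_(k < N) w r k * (x ^+ k)%:C) <= B) ->
  l1norm (\sum_(r < n) P r * V r + Q -
      \sum_(i < K) (\sum_(r < n) \sum_(k < i.+1) a r (i - k)%N * w r k + b i) * (x ^+ i)%:C)
  <= n%:R * (A * B) + n.+1%:R * (N%:R * (M * A * (Lam * x) ^+ K)).
Proof.
move=> KN N0 A0 M1 Lam0 x0 y1 wM Pa Qb VB.
have M0 : 0 <= M by rewrite (le_trans ler01).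
have y0 : 0 <= Lam * x by rewrite mulr_ge0.
set e := N%:R * (M * A * (Lam * x) ^+ K).
pose D r := V r - \sum_(k < N) w r k * (x ^+ k)%:C.
pose G r := P r * (\sum_(k < N) w r k * (x ^+ k)%:C) -
  \sum_(i < K) (\sum_(k < i.+1) a r (i - k)%N * w r k) * (x ^+ i)%:C.
pose Z := Q - \sum_(i < K) b i * (x ^+ i)%:C.
have -> : \sum_(r < n) P r * V r + Q -
    \sum_(i < K) (\sum_(r < n) \sum_(k < i.+1) a r (i - k)%N * w r k + b i) * (x ^+ i)%:C =
    \sum_(r < n) P r * D r + (\sum_(r < n) G r + Z).
  under [X in _ - X]eq_bigr do rewrite mulrDl big_distrl/=.
  rewrite big_split/= exchange_big/= opprD addrACA [RHS]addrA; congr (_ + _).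
  by rewrite -sumrB -big_split; apply: eq_bigr => r _; rewrite /G /D /=; ring.
have PA r : l1norm (P r) <= A by have := Pa r 0%N; rewrite big_ord0 subr0 expr0 mulr1.
have cst_sum (u : R) : n%:R * u = \sum_(r < n) u by rewrite sumr_const card_ord mulr_natl.
apply: (le_trans (l1normD _ _)); apply: lerD.
  apply: (le_trans (l1norm_sum _ _ _)); rewrite cst_sum; apply: ler_sum => r _.
  by apply: (le_trans (l1normM _ _)); rewrite ler_pM ?l1norm_ge0//; exact: VB.
rewrite -natr1 mulrDl mul1r; apply: (le_trans (l1normD _ _)); apply: lerD.
  apply: (le_trans (l1norm_sum _ _ _)); rewrite cst_sum; apply: ler_sum => r _.
  exact: truncated_product_bound.
apply: (le_trans (Qb K)); rewrite /e mulrA ler_wpM2r ?exprn_ge0// mulrA ler_peMl//.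
by have := ler_pM ler01 ler01 (_ : 1 <= N%:R) M1; rewrite mulr1 ler1n; apply.
Qed.

(** The factor N, which comes from counting the terms of a truncated Cauchy
    product, is at most 2^N and turns the decay 4^-N into 2^-N. *)
Lemma natr_mul_quarter_expr (m N : nat) (y : R) : (m <= N)%N -> 0 <= y <= 4^-1 ->
  N%:R * y ^+ (N - m) <= 4 ^+ m * 2^-1 ^+ N.
Proof.
move=> mN /andP[y0 y4].
have -> : 4 ^+ m * 2^-1 ^+ N = 2 ^+ N * 4^-1 ^+ (N - m) :> R.
  have E : 4^-1 ^+ N = 4^-1 ^+ (N - m) * 4^-1 ^+ m :> R by rewrite -exprD subnK.
  have -> : 4^-1 ^+ (N - m) = 4 ^+ m * 4^-1 ^+ N :> R.
    by rewrite E mulrCA -exprMn divff ?expr1n ?mulr1// pnatr_eq0.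
  by rewrite [RHS]mulrCA -exprMn; congr (_ * _ ^+ _); lra.
apply: ler_pM; rewrite ?exprn_ge0//; last by rewrite lerXn2r ?nnegrE// invr_ge0.
by rewrite -natrX ler_nat ltnW// ltn_expl.
Qed.

(** I^theta raises the degree in z = t^(1/q) by m = theta q. *)
Lemma frac_int_truncation (theta : R) (m q N : nat) (H : nat -> R[i]) (t : R) :
  0 < theta -> theta = m%:R / q%:R -> 0 <= t ->
  frac_int theta (fun s => \sum_(i < N - m) H i * (s `^ (i%:R / q%:R))%:C) t =
  \sum_(m <= k < N) (frac_int_coef theta ((k - m)%N%:R / q%:R))%:C * H (k - m)%N *
    (t `^ (k%:R / q%:R))%:C.
Proof.
move=> th0 thE t0.
have mp i : cbmeas t (fun s : R => (s `^ (i%:R / q%:R))%:C).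
  by apply: cbmeas_powR; rewrite divr_ge0.
rewrite frac_int_sum//; last by move=> i; apply: cbmeasM => //; exact: cbmeas_cst.
rewrite -[in RHS](add0n m) big_addn big_mkord add0n; apply: eq_bigr => i _.
rewrite frac_intZ// frac_int_powR ?divr_ge0// addnK mulrCA mulrA.
by congr (_ * _%:C); rewrite natrD mulrDl -thE addrC.
Qed.

Lemma psi_plus_series (theta : R) (q m N : nat) (v0 W vbar : nat -> R[i]) (t : R) :
  (0 < q)%N -> 0 <= t -> (m <= N)%N -> (nceil theta * q <= N)%N ->
  (forall k, W k = psi_coef q theta v0 k + vbar k) ->
  (forall k, (k < m)%N -> vbar k = 0) ->
  psi theta v0 t + \sum_(m <= k < N) vbar k * (t `^ (k%:R / q%:R))%:C =
  \sum_(k < N) W k * ((t `^ q%:R^-1) ^+ k)%:C.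
Proof.
move=> q0 t0 mN cN WE vm; rewrite (psi_series v0 q0 t0 cN).
under [RHS]eq_bigr do rewrite WE mulrDl.
rewrite big_split/=; congr (_ + _).
rewrite -(big_mkord xpredT (fun k => vbar k * ((t `^ q%:R^-1) ^+ k)%:C)).
rewrite [RHS](big_cat_nat (n := m))//= [X in _ = X + _](_ : _ = 0) ?add0r; last first.
  by rewrite big_nat big1// => k /andP[_ km]; rewrite vm// mul0r.
by apply: eq_bigr => k _; rewrite powR_root.
Qed.

(** With y = t^(1/q), the left-hand side bounds I^theta of a function that is
    at most n A B + e.  The three conditions on Lam make the operator halve B
    without enlarging e. *)
Lemma contraction_constants (n : nat) (kappa A B Lam y e : R) : 0 <= y -> 0 <= e -> 0 <= B ->
  0 <= kappa -> 0 <= A -> Lam * y <= 4^-1 -> 8 * kappa <= Lam -> kappa * A * n%:R <= Lam ->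
  2 * kappa * y * (n%:R * (A * B) + e) <= B / 2 + e.
Proof.
move=> y0 e0 B0 k0 A0 y4 k8 kAn.
have k1 : 2 * kappa * y <= 1.
  by have := ler_wpM2r y0 k8; lra.
have k2 : 2 * (kappa * A * n%:R * y) <= 2^-1.
  by have := ler_wpM2r y0 kAn; lra.
rewrite mulrDr; apply: lerD; last by rewrite ler_piMl.
have -> : 2 * kappa * y * (n%:R * (A * B)) = B * (2 * (kappa * A * n%:R * y)) by ring.
by rewrite ler_wpM2l.
Qed.

End Truncation.

(** * The series represents every solution *)

Section Series.
Context {R : realType}.

Definition total_rhs (n : nat) (p : 'I_n -> 'I_n.+1 -> R -> R[i]) (v : 'I_n -> R -> R[i])
    (j : 'I_n) (s : R) : R[i] :=
  \sum_(r < n) rhs_coef p j r s * v r s + rhs_source p j s.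

(** The constants Lam and delta come from majorants of the p_(j,r), so they are
    fixed before v is given.  For a solution v, the difference d_N = v - S_N is
    I^theta of the right-hand side at v minus the truncated series h_N of the
    right-hand side; [rhs_residual_bound] estimates the latter difference in
    terms of d_N itself, and [halving_iteration] removes d_N from the bound. *)
Lemma fractional_series (n : nat) (T : R) (theta : 'I_n -> R) (m : 'I_n -> nat) (q : nat)
    (p : 'I_n -> 'I_n.+1 -> R -> R[i]) (pbar : 'I_n -> 'I_n.+1 -> R[i] -> R[i])
    (v0 : 'I_n -> nat -> R[i]) :
  0 < T -> (0 < q)%N -> (forall j, (0 < m j)%N) ->
  (forall j, theta j = (m j)%:R / q%:R) ->
  (forall j r, continuous (p j r : R -> R[i]^o)) ->
  (forall j r t, 0 <= t -> p j r t = pbar j r (t `^ q%:R^-1)%:C) ->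
  (forall j r, analytic_at (pbar j r) 0) ->
  exists (vbar : 'I_n -> nat -> R[i]) (delta : R), 0 < delta <= T /\
    forall v : 'I_n -> R -> R[i],
    (forall j, {within `[0, T], continuous (v j : R -> R[i]^o)}) ->
    (forall j t, 0 <= t <= T ->
      v j t = psi (theta j) (v0 j) t + frac_int (theta j) (total_rhs p v j) t) ->
    forall (j : 'I_n) (t : R), 0 <= t < delta ->
      (fun N : nat =>
         psi (theta j) (v0 j) t
         + \sum_(m j <= mu < N)
             vbar j mu * (t `^ (mu%:R / q%:R))%:C : R[i]^o) @ \oo
        --> (v j t : R[i]^o).
Proof.
move=> T0 q0 m0 thE pc pE pan.
have [a [A [L [A0 L1 aL tail]]]] := uniform_majorant (fun jr : 'I_n * 'I_n.+1 => pan jr.1 jr.2).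
have q0R : 0 < q%:R :> R by rewrite ltr0n.
have th0 j : 0 < theta j by rewrite thE divr_gt0// ltr0n.
pose c j i : R := frac_int_coef (theta j) (i%:R / q%:R).
pose kappa := \sum_j frac_int_coef (theta j) 0.
have kth j : frac_int_coef (theta j) 0 <= kappa.
  by apply: (@ler_term_sum _ _ (fun j => frac_int_coef (theta j) 0)) => i; exact: frac_int_coef_ge0.
have ck j i : 0 <= c j i <= kappa.
  rewrite frac_int_coef_ge0//=; apply: le_trans (kth j); exact: frac_int_coef_le.
have kap0 : 0 <= kappa by apply: sumr_ge0 => j _; exact: frac_int_coef_ge0.
pose psc j := psi_coef q (theta j) (v0 j).
pose M := 1 + 2 * \sum_j \sum_(i < nceil (theta j)) l1norm (v0 j i / i`!%:R).
have S0 j : 0 <= \sum_(i < nceil (theta j)) l1norm (v0 j i / i`!%:R).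
  by apply: sumr_ge0 => i _; exact: l1norm_ge0.
have M1 : 1 <= M by rewrite lerDl mulr_ge0// sumr_ge0.
have M0 : 0 <= M by rewrite (le_trans ler01).
have pscM j k : l1norm (psc j k) <= M / 2.
  rewrite ler_pdivlMr// mulrC
    (le_trans _ (_ : 2 * \sum_j \sum_(i < nceil (theta j)) l1norm (v0 j i / i`!%:R) <= M))//.
    rewrite ler_wpM2l//; apply: (le_trans (psi_coef_bound _ _ _ _)).
    exact: (@ler_term_sum _ _ (fun j => \sum_(i < nceil (theta j)) l1norm (v0 j i / i`!%:R))).
  by rewrite lerDr.
pose w0 (r : 'I_n) : 'I_n.+1 := widen_ord (leqnSn n) r.
pose aa (j r : 'I_n) := a (j, w0 r).
pose bb (j : 'I_n) := a (j, ord_max).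
have [W WE] := @recursion_exists R n m c aa bb psc m0.
(* The first two terms are what recursion_bound asks for; the second and the
   third make the Volterra operator a contraction where Lam t^(1/q) <= 1/4. *)
pose Lam := 2 * L + 2 * (kappa * A * (2 * n%:R + 1)) + 8 * kappa.
have kA0 : 0 <= kappa * A * (2 * n%:R + 1).
  by rewrite !mulr_ge0// addr_ge0// mulr_ge0.
have LamL : 2 * L <= Lam by rewrite /Lam; lra.
have Lamk : 2 * (kappa * A * (2 * n%:R + 1)) <= Lam by rewrite /Lam; lra.
have Lam8 : 8 * kappa <= Lam by rewrite /Lam; lra.
have Lam2 : 2 <= Lam by rewrite /Lam; lra.
have Lam0 : 0 < Lam by lra.
have kAn : kappa * A * n%:R <= Lam.
  apply: le_trans Lamk; rewrite mulrCA ler_wpM2l ?mulr_ge0//.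
  by have : (0 : R) <= n%:R by []; lra.
have WM : forall j k, l1norm (W j k) <= M * Lam ^+ k.
  apply: (recursion_bound m0 ck A0 L1 M1 _ _ pscM LamL Lamk WE).
    by move=> j r k; exact: aL.
  by move=> j k; exact: aL.
pose H j i := cauchy_coef aa bb W j i.
pose vbar j k : R[i] := if (m j <= k)%N then (c j (k - m j)%N)%:C * H j (k - m j)%N else 0.
(* zeta is the radius in the variable t^(1/q), and delta the one in t. *)
pose zeta := (4 * Lam)^-1.
have zeta0 : 0 < zeta by rewrite invr_gt0 mulr_gt0.
pose delta := Num.min T (zeta ^+ q).
exists vbar, delta; split.
  by rewrite lt_min T0 exprn_gt0//= ge_min lexx.
move=> v cv vE.
pose z (t : R) : R := t `^ q%:R^-1.
have z0 t : 0 <= z t by exact: powR_ge0.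
have zd t : 0 <= t < delta -> Lam * z t <= 4^-1.
  move=> /andP[t0]; rewrite lt_min => /andP[_ tz].
  have : z t <= zeta.
    have zq : (zeta ^+ q) `^ q%:R^-1 = zeta.
      by rewrite -powR_mulrn ?(ltW zeta0)// -powRrM (divff (lt0r_neq0 q0R)) powRr1 ?(ltW zeta0).
    by rewrite /z -zq ge0_ler_powR ?nnegrE ?invr_ge0 ?exprn_ge0 ?(ltW zeta0) ?(ltW tz).
  by rewrite /zeta invfM ler_pdivlMr// mulrC.
have zd1 t : 0 <= t < delta -> Lam * z t <= 1.
  by move=> td; apply: (le_trans (zd t td)); rewrite invf_le1// ler1n.
have z1 t : 0 <= t < delta -> z t <= 1.
  move=> td; apply: le_trans (zd1 t td); rewrite ler_peMl//.
  by apply: le_trans Lam2; rewrite ler1n.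
have dT t : 0 <= t < delta -> 0 <= t <= T.
  by move=> /andP[t0]; rewrite lt_min => /andP[/ltW tT _]; rewrite t0.
have LLam : L <= Lam.
  by apply: le_trans LamL; rewrite ler_peMl ?(le_trans ler01)// ler1n.
have tailp j r t : 0 <= t < delta -> forall K,
    l1norm (p j r t - \sum_(k < K) a (j, r) k * (z t ^+ k)%:C) <= A * (Lam * z t) ^+ K.
  move=> td K; have /andP[t0 _] := td.
  have LL : L * z t <= Lam * z t by rewrite ler_wpM2r.
  rewrite (pE j r t t0); apply: (le_trans (tail (j, r) (z t) (z0 t) _ K)).
    by rewrite (le_trans LL)// (le_trans (zd t td))// lef_pV2 ?posrE// ler_nat.
  rewrite ler_wpM2l// lerXn2r ?nnegrE ?mulr_ge0 ?(ltW Lam0)//.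
  exact: le_trans L1.
pose S N j t : R[i] := psi (theta j) (v0 j) t +
  \sum_(m j <= k < N) vbar j k * (t `^ (k%:R / q%:R))%:C.
pose h N j s : R[i] := \sum_(i < N - m j) H j i * (s `^ (i%:R / q%:R))%:C.
(* For N >= N0, the indices below N cover all of psi and the first term of the
   series of every component. *)
pose N0 := (\sum_j (nceil (theta j) * q) + \sum_j m j + 1)%N.
have N0m j : (m j <= N0)%N.
  by rewrite /N0 (bigD1 (P := predT) (F := m) j)//= -addnA addnCA -addnA leq_addr.
have N0c j : (nceil (theta j) * q <= N0)%N.
  by rewrite /N0 (bigD1 (P := predT) (F := fun i => (nceil (theta i) * q)%N) j)//= -!addnA leq_addr.
have SW N j t : (N0 <= N)%N -> 0 <= t -> S N j t = \sum_(k < N) W j k * (z t ^+ k)%:C.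
  move=> NN t0; apply: (psi_plus_series q0 t0).
  - exact: leq_trans NN.
  - exact: leq_trans NN.
  - by move=> k; rewrite WE.
  - by move=> k km; rewrite /vbar leqNgt km.
have Sh N j t : 0 <= t -> S N j t = psi (theta j) (v0 j) t + frac_int (theta j) (h N j) t.
  move=> t0; congr (_ + _); rewrite (frac_int_truncation _ _ (th0 j) (thE j) t0).
  by rewrite big_nat [RHS]big_nat; apply: eq_bigr => k /andP[mk _]; rewrite /vbar mk.
have ch N j t : cbmeas t (h N j).
  apply: cbmeas_sum => i; apply: cbmeasM; first exact: cbmeas_cst.
  by apply: cbmeas_powR; rewrite divr_ge0.
have cp j r t : 0 <= t -> cbmeas t (p j r).
  by move=> t0; apply: cbmeas_continuous => //; apply: continuous_subspaceT; exact: pc.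
have cvt j t : 0 <= t <= T -> cbmeas t (v j).
  by move=> /andP[t0 tT]; apply: (cbmeasS tT); apply: cbmeas_continuous => //; exact: ltW.
have cG N j t : 0 <= t <= T -> cbmeas t (fun s => total_rhs p v j s - h N j s).
  move=> tT; have /andP[t0 _] := tT; apply: cbmeasB => //.
  apply: cbmeasD; last exact: cp.
  by apply: cbmeas_sum => r; apply: cbmeasM; [exact: cp|exact: cvt].
pose d N j t := v j t - S N j t.
have dE N j t : 0 <= t < delta ->
    d N j t = frac_int (theta j) (fun s => total_rhs p v j s - h N j s) t.
  move=> td; have tT := dT t td; have /andP[t0 _] := tT.
  rewrite /d (vE j t tT) (Sh N j t t0) opprD addrACA subrr add0r.
  apply/eqP; rewrite subr_eq -frac_intD//; last exact: cG.
  by apply/eqP/eq_frac_int => s _; rewrite subrK.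
(* The residual; 4 ^+ (\sum_j m j) pays for truncating at N - m j instead of N. *)
pose E N : R := n.+1%:R * (M * A * 4 ^+ (\sum_j m j)) * 2^-1 ^+ N.
have E0 N : 0 <= E N by rewrite !mulr_ge0 ?exprn_ge0 ?invr_ge0.
have resid N j s B : (N0 <= N)%N -> 0 <= s < delta ->
    (forall r, l1norm (d N r s) <= B) ->
    l1norm (total_rhs p v j s - h N j s) <= n%:R * (A * B) + E N.
  move=> NN sd dB; have /andP[s0 _] := sd.
  have hE : h N j s = \sum_(i < N - m j) H j i * (z s ^+ i)%:C.
    by apply: eq_bigr => i _; rewrite powR_root.
  rewrite hE; apply: (le_trans (rhs_residual_bound (leq_subr _ _) _ A0 M1 (ltW Lam0) (z0 s)
    (zd1 s sd) WM (fun r k => tailp j (w0 r) s sd k) (fun k => tailp j ord_max s sd k) _)).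
  - by rewrite (leq_trans _ NN)// /N0 addn1.
  - by move=> r; rewrite -SW//; exact: dB.
  rewrite lerD2l /E -!mulrA ler_wpM2l// mulrCA ler_wpM2l// mulrCA ler_wpM2l//.
  have y4 : 0 <= Lam * z s <= 4^-1 by rewrite mulr_ge0 ?(ltW Lam0)//= zd.
  apply: (le_trans (natr_mul_quarter_expr (leq_trans (N0m j) NN) y4)).
  rewrite ler_wpM2r ?exprn_ge0 ?invr_ge0// ler_weXn2l ?ler1n//.
  by rewrite (bigD1 (P := predT) (F := m) j)//= leq_addr.
have contr N B : (N0 <= N)%N -> (forall j t, 0 <= t < delta -> l1norm (d N j t) <= B) ->
    (forall j t, 0 <= t < delta -> l1norm (d N j t) <= B / 2 + E N).
  move=> NN dB j t td; have /andP[t0 tdel] := td.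
  have B0 : 0 <= B by exact: le_trans (l1norm_ge0 _) (dB j t td).
  have tz : t `^ theta j <= z t.
    by rewrite thE powR_root// -/(z t) -(prednK (m0 j)) exprS ler_piMr ?exprn_ile1 ?z1.
  apply: le_trans (contraction_constants (z0 t) (E0 N) B0 kap0 A0 (zd t td) Lam8 kAn).
  rewrite (dE N j t td).
  apply: (le_trans (frac_int_bound (th0 j) t0 (cG N j t (dT t td)) _)).
    move=> s /andP[s0 st]; have sd : 0 <= s < delta by rewrite s0 (le_lt_trans st).
    by apply: (resid N j s B NN sd) => r; exact: dB.
  apply: ler_wpM2r; first by rewrite addr_ge0// !mulr_ge0.
  have p0 : 0 <= 2 * frac_int_coef (theta j) 0 by apply: mulr_ge0 => //; exact: frac_int_coef_ge0.
  by rewrite ler_pM ?powR_ge0// ler_wpM2l.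
(* Some bound, of any size, is needed to start the iteration. *)
have bnd N : (N0 <= N)%N -> exists B, forall j t, 0 <= t < delta -> l1norm (d N j t) <= B.
  move=> NN.
  have vb j : exists b : R, 0 <= b /\ forall s, 0 <= s <= T -> l1norm (v j s) <= b.
    by apply: cbmeas_bound; apply: cvt; rewrite lexx ltW.
  have [F HF] := choice vb.
  have F0 j : 0 <= F j by have [] := HF j.
  exists (\sum_j F j + M * 2) => j t td; have /andP[t0 _] := td.
  apply: (le_trans (l1normB _ _)); apply: lerD.
    apply: le_trans (ler_term_sum j F0); have [_ h1] := HF j; exact/h1/dT.
  rewrite (SW N j t NN t0); apply: (le_trans (l1norm_sum _ _ _)).
  apply: (@le_trans _ _ (\sum_(k < N) M * (Lam * z t) ^+ k)).
    apply: ler_sum => k _; rewrite mulrC l1norm_realM ger0_norm ?exprn_ge0//.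
    by rewrite exprMn mulrA mulrC ler_wpM2r ?exprn_ge0.
  rewrite -big_distrr/= ler_wpM2l// geometric_sum_le2//.
  rewrite mulr_ge0 ?(ltW Lam0)//= (le_trans (zd t td))//.
  by rewrite lef_pV2 ?posrE// ler_nat.
have final N j t : (N0 <= N)%N -> 0 <= t < delta -> l1norm (d N j t) <= 2 * E N.
  move=> NN td; apply/ler_addgt0Pr => eta eta0.
  have [B HB] := bnd N NN.
  apply: (@halving_iteration _ (fun b => forall j t, 0 <= t < delta -> l1norm (d N j t) <= b)
    B (E N)) => //.
    by move=> b b' bb' Pb i s sd; apply: (le_trans (Pb i s sd)).
  by move=> b Pb; exact: contr.
move=> j t td; apply/cvg_l1normP => e e0.
have cvE : E N @[N --> \oo] --> (0 : R).
  rewrite -[X in _ --> X](mulr0 (n.+1%:R * (M * A * 4 ^+ (\sum_j m j)))).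
  apply: cvgMr; apply: cvg_expr; rewrite ger0_norm ?invr_ge0//.
  by rewrite invf_lt1// ltr1n.
have e2 : 0 < e / 2 by rewrite divr_gt0.
have hE := cvgr0_norm_lt _ cvE _ e2.
near=> N.
have NN : (N0 <= N)%N by near: N; exists N0.
apply: (le_lt_trans (final N j t NN td)).
rewrite mulrC -ltr_pdivlMr//; apply: le_lt_trans (ler_norm _) _.
by near: N; exact: hE.
Unshelve. all: by end_near. Qed.

End Series.

Theorem theorem2p1 (R : realType) (n : nat) (hn : (1 <= n)%N)
  (T : R) (hT : 0 < T)
  (gam den : 'I_n -> nat)
  (hgam : forall j, (1 <= gam j)%N)
  (hden : forall j, (2 <= den j)%N)
  (hcop : forall j, coprime (gam j) (den j))
  (theta : 'I_n -> R)
  (htheta : forall j, theta j = (gam j)%:R / (den j)%:R)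
  (q : nat) (hq : q = \big[lcmn/1%N]_(j < n) den j)
  (omega : R) (homega : 1 < omega)
  (f p : 'I_n -> 'I_n.+1 -> R -> R[i])
  (pbar : 'I_n -> 'I_n.+1 -> R[i] -> R[i])
  (hpper : forall j r, exists P : R, 0 < P /\ periodic (p j r) P)
  (hpcont : forall j r, continuous (p j r : R -> R[i]^o))
  (hpf : forall j r t, p j r t = f j r t * cexpi (omega * t))
  (hpbar : forall j r t, 0 <= t -> p j r t = pbar j r (t `^ (q%:R)^-1)%:C)
  (hanal : forall j r, analytic_at (pbar j r) 0)
  (v0 : 'I_n -> nat -> R[i]) :
  exists (vbar : 'I_n -> nat -> R[i]) (delta : R),
    0 < delta <= T /\
    forall v : 'I_n -> R -> R[i], ivp_solution T theta p v0 v ->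
    forall (j : 'I_n) (t : R), 0 <= t < delta ->
      (fun N : nat =>
         psi (theta j) (v0 j) t
         + \sum_((gam j * (q %/ den j))%N <= mu < N)
             vbar j mu * (t `^ (mu%:R / q%:R))%:C : R[i]^o) @ \oo
        --> (v j t : R[i]^o).
Proof.
have den0 j : (0 < den j)%N by rewrite (leq_trans _ (hden j)).
have q0 : (0 < q)%N.
  by rewrite hq; elim/big_ind: _ => // x y x0 y0; rewrite lcmn_gt0 x0.
have dq j : (den j %| q)%N by rewrite hq (bigD1 j)//= dvdn_lcml.
pose m j := (gam j * (q %/ den j))%N.
have m0 j : (0 < m j)%N by rewrite muln_gt0 hgam divn_gt0// dvdn_leq.
have thE j : theta j = (m j)%:R / q%:R.
  have qE : (q %/ den j)%N%:R = q%:R / (den j)%:R :> R.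
    by rewrite -{2}(divnK (dq j)) natrM mulfK// pnatr_eq0 -lt0n.
  rewrite htheta /m natrM qE mulrA mulrAC mulfK//.
  by rewrite pnatr_eq0 -lt0n.
have th0 j : 0 < theta j by rewrite thE divr_gt0 ?ltr0n.
have [vbar [delta [dT main]]] := fractional_series v0 hT q0 m0 thE hpcont hpbar hanal.
exists vbar, delta; split => // v [cv sol]; apply: main => // j t tT.
have /andP[t0 tT'] := tT.
have cp i r : cbmeas t (p i r).
  by apply: cbmeas_continuous => //; apply: continuous_subspaceT; exact: hpcont.
have cvt i : cbmeas t (v i).
  by apply: (cbmeasS tT'); apply: cbmeas_continuous => //; exact: ltW.
case: sol => [[D HD]|vol].
  have [dD cap D0] := HD j.
  apply: (caputo_volterra (ltW hT) _ dD D0 _ tT).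
    by rewrite th0 htheta nceil_ratio_gt// hgam.
  by move=> s sT; rewrite cap ?in_itv.
rewrite vol ?in_itv//= -addrA; congr (_ + _).
have cpv r : cbmeas t (fun s => rhs_coef p j r s * v r s).
  by apply: cbmeasM; [exact: cp|exact: cvt].
rewrite -frac_int_sum// -frac_intD//; last exact: cp.
exact: cbmeas_sum.
Qed.
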